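(* There is an action of $\mathbb{A}^*=\mathbb{A}_{q^{-1}}$ on $V_*=\bigoplus_{k\ge0}V_k$, whose generators $T_i^*,d_-^*,d_+^*,e_i^*$ act by $$T_i^*=T_i^{-1},\quad d_-^*=d_-,\quad e_i^*=e_i,\quad (d_+^*F)[X]=\gamma\,F[X+(q-1)y_{k+1}]\quad(F\in V_k),$$ where $\gamma$ is the operator which sends $y_i$ to $y_{i+1}$ for $i=1,\dots,k$ and $y_{k+1}$ to $ty_1$. Furthermore, it satisfies the additional relations (as operators on $V_k$, $k\ge0$, $1\le i\le k$) $$z_{i+1}d_+=d_+z_i,\qquad y_{i+1}d_+^*=d_+^*y_i,\qquad z_1d_+=-tq^{k+1}y_1d_+^*,$$ and $(d_+^* )^m(1)=d_+^m(1)$ for every $m\ge1$, where $1\in V_0$.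
   Context: **The algebra.** For a parameter $q$, $\mathbb{A}_q$, over $\mathbb{Q}(q,t)$, is the path algebra of the quiver with vertex set $\mathbb{Z}_{\ge0}$, arrows $d_+$ from $i$ to $i+1$, arrows $d_-$ from $i+1$ to $i$, and loops $T_1,\dots,T_{k-1}$ at each vertex $k$, with vertex idempotents $e_k$, modulo the relations $$(T_i-1)(T_i+q)=0,\quad T_iT_{i+1}T_i=T_{i+1}T_iT_{i+1},\quad T_iT_j=T_jT_i\ (|i-j|>1),$$ $$T_id_-=d_-T_i\ (i<k-1),\quad d_+T_i=T_{i+1}d_+,\quad T_1d_+^2=d_+^2,\quad d_-^2T_{k-1}=d_-^2,$$ $$d_-(d_+d_--d_-d_+)T_{k-1}=q(d_+d_--d_-d_+)d_-\ (k\ge2),\qquad T_1(d_+d_--d_-d_+)d_+=q\,d_+(d_+d_--d_-d_+),$$ where $k$ is the index of the starting vertex, products are composed right to left, and each relation is imposed wherever it makes sense. $\mathbb{A}^*=\mathbb{A}_{q^{-1}}$ is the same algebra with $q$ replaced by $q^{-1}$, with generators denoted $d_\pm^*,T_i^*,e_i^*$. **The operators.** $\mathrm{Sym}[X]$ is the ring of symmetric functions over $\mathbb{Q}(q,t)$ in $X=x_1+x_2+\cdots$. Plethysm: $F[A]$ is the image of $F$ under the $\mathbb{Q}(q,t)$-algebra homomorphism $p_n\mapsto p_n[A]$, with $p_n[A]$ obtained from $A$ by replacing every variable (including $q,t,x_i,y_i,z$) by its $n$-th power and fixing rational numbers. $\mathrm{Exp}[A]=\sum_{n\ge0}h_n[A]$.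 $(B_rF)[X]=F[X-(q-1)z^{-1}]\,\mathrm{Exp}[-zX]\big|_{z^r}$ (coefficient of $z^r$). $V_k=\mathrm{Sym}[X]\otimes\mathbb{Q}[y_1,\dots,y_k]$; for $F\in V_k$, $F[A]$ substitutes $X\mapsto A$ with the $y_i$ fixed. $e_k:V_*\to V_k$ is the projection. $T_iP=\dfrac{(q-1)y_iP+(y_{i+1}-qy_i)\,s_iP}{y_{i+1}-y_i}$ on $V_k$, $1\le i\le k-1$, where $s_i$ swaps $y_i,y_{i+1}$; $T_i$ is invertible. $d_+:V_k\to V_{k+1}$, $d_+F=T_1\cdots T_k\big(F[X+(q-1)y_{k+1}]\big)$. $d_-:V_k\to V_{k-1}$ is linear with $d_-(y_k^iF)=-B_{i+1}F$ for $F$ not depending on $y_k$. $y_i$ denotes multiplication by $y_i$ on $V_k$ ($i\le k$). **The elements $z_i$.** On $V_k$ the operators $y_i$ are expressed through $\mathbb{A}_q$ by $y_1=\frac{1}{q^{k-1}(q-1)}(d_+d_--d_-d_+)T_{k-1}\cdots T_1$ and $y_i=q^{-1}T_iy_{i+1}T_i$. The $z_i$ are the images of these under the isomorphism $\mathbb{A}\to\mathbb{A}^*$, antilinear for $q\mapsto q^{-1}$, sending generators to generators; i.e. on $V_k$ $$z_1=\frac{q^{k-1}}{q^{-1}-1}(d_+^*d_--d_-d_+^* )T_{k-1}^{-1}\cdots T_1^{-1},\qquad z_{i+1}=q^{-1}T_iz_iT_i .$$ *)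

(* Defs.v *)
From HB Require Import structures.
From mathcomp Require Import all_boot all_order all_algebra finmap.
From mathcomp.multinomials Require Import monalg.
From mathcomp.multinomials Require Import mpoly.
From Stdlib Require Import ClassicalEpsilon.

Set Implicit Arguments.
Unset Strict Implicit.
Unset Printing Implicit Defensive.

Import GRing.Theory.
Local Open Scope ring_scope.


Definition Qqt : fieldType := {fraction mpoly.mpoly 2 rat}.
Definition q_ : Qqt := FracField.tofrac ('X_(0 : 'I_2) : mpoly.mpoly 2 rat).
Definition t_ : Qqt := FracField.tofrac ('X_(1 : 'I_2) : mpoly.mpoly 2 rat).

(* Everything below is written over a field K with two elements q and t; it is
   used for K = Q(q,t).  Over a field of characteristic 0, Sym[X] is the
   polynomial ring on the power sums p_1, p_2, p_3, ... (this freeness is what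
   makes plethysm, prescribed on the p_n, well defined).  We take this as its
   construction: the variable of index n : nat is p_{n+1}. *)

Definition Sym (K : fieldType) : comNzRingType := {malg K[{cmonom nat}]}.

Section SymmetricFunctions.
Variable K : fieldType.

Definition symC (c : K) : Sym K := @mkmalgU {cmonom nat} K (@monalg.onecm nat) c.

(* p_n, for n >= 1 *)
Definition psum (n : nat) : Sym K := @mkmalgU {cmonom nat} K (@monalg.ucm nat n.-1) 1.

(* F |-> F[A] with values in a commutative ring B containing K through c;
   the argument a is the sequence n |-> p_n[A] (n >= 1). *)
Definition pleth (B : comNzRingType) (c : K -> B) (a : nat -> B) (F : Sym K) : B :=
  monalg.mmap c
    (fun m : {cmonom nat} => \prod_(i <- finsupp (m : {fsfun nat -> nat with 0%N}))
       a i.+1 ^+ m i) F.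

(* The complete homogeneous functions [:: h_0; ...; h_n], by Newton's identity
   n h_n = p_1 h_(n-1) + ... + p_n h_0. *)
Fixpoint hseq (n : nat) : seq (Sym K) :=
  if n is n'.+1 then
    let s := hseq n' in
    rcons s (symC (n'.+1%:R)^-1 * \sum_(i < n'.+1) psum i.+1 * s`_(n' - i))
  else [:: 1].
Definition hsym (n : nat) : Sym K := (hseq n)`_n.

(* h_n[-X].  As h_n[-zX] = z^n h_n[-X], this is the coefficient of z^n in
   Exp[-zX]. *)
Definition hneg (n : nat) : Sym K := pleth symC (fun m => - psum m) (hsym n).

End SymmetricFunctions.


(* V_k = Sym[X] (x) Q[y_1, ..., y_k] *)
Definition V (K : fieldType) (k : nat) : comNzRingType := mpoly.mpoly k (Sym K).

Section Operators.
Variables (K : fieldType) (q t : K).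

Definition symV k (F : Sym K) : V K k := mpolyC k F.
Definition scalV k (c : K) : V K k := symV k (symC c).

(* y_i for 1 <= i <= k; it is 0 for the other values of i, which never occur. *)
Definition yv k (i : nat) : V K k := \sum_(j < k | j.+1 == i) ('X_j : mpoly.mpoly k (Sym K)).

(* The ring homomorphism V_k -> B with c on K, p_n |-> a n and y_i |-> b i. *)
Definition substV k (B : comNzRingType) (c : K -> B) (a b : nat -> B) (F : V K k) : B :=
  mpoly.mmap (pleth c a) (fun j : 'I_k => b j.+1) F.

Definition psumV k (n : nat) : V K k := symV k (psum K n).

(* N / D for an exact quotient: the C such that C * D = N *)
Definition exquo k (N D : V K k) : V K k :=
  epsilon (inhabits 0) (fun C => C * D = N).

(* the inverse of a bijective operator *)
Definition opinv k (f : V K k -> V K k) (G : V K k) : V K k :=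
  epsilon (inhabits 0) (fun F => f F = G).

Definition swap_index (i j : nat) : nat :=
  if j == i then i.+1 else if j == i.+1 then i else j.

Definition sop k (i : nat) (P : V K k) : V K k :=
  substV (@scalV k) (@psumV k) (fun j => yv k (swap_index i j)) P.

(* T_i on V_k, for 1 <= i <= k-1 *)
Definition Top k (i : nat) (P : V K k) : V K k :=
  exquo (scalV k (q - 1) * yv k i * P + (yv k i.+1 - scalV k q * yv k i) * sop i P)
        (yv k i.+1 - yv k i).

Definition Tinv k (i : nat) : V K k -> V K k := opinv (@Top k i).

(* F[X + (q-1) y_{k+1}], where p_n[X + (q-1) y_{k+1}] = p_n + (q^n-1) y_{k+1}^n *)
Definition shiftX k (F : V K k) : V K k.+1 :=
  substV (@scalV k.+1)
    (fun n => psumV k.+1 n + scalV k.+1 (q ^+ n - 1) * yv k.+1 k.+1 ^+ n)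
    (yv k.+1) F.

Definition dplus k (F : V K k) : V K k.+1 :=
  foldr (fun i G => Top i G) (shiftX F) (iota 1 k).

(* F[X - (q-1) z^{-1}] as a polynomial in the variable 'X = z^{-1}:
   p_n[X - (q-1) z^{-1}] = p_n - (q^n-1) z^{-n}. *)
Definition shiftZ k (F : V K k) : {poly V K k} :=
  substV (fun c => (scalV k c)%:P)
    (fun n => (psumV k n)%:P - (scalV k (q ^+ n - 1))%:P * 'X^n)
    (fun i => (yv k i)%:P) F.

(* B_r for r >= 0: the coefficient of z^r in F[X - (q-1) z^{-1}] Exp[-zX] *)
Definition Bop k (r : nat) (F : V K k) : V K k :=
  \sum_(j < size (shiftZ F)) (shiftZ F)`_j * symV k (hneg K (r + j)).

(* muni writes an element of V_{k+1} as a polynomial in y_{k+1} over V_k. *)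
Definition dminus k (F : V K k.+1) : V K k :=
  - \sum_(i < size (muni F)) Bop i.+1 ((muni F)`_i : V K k).

(* gamma : y_i |-> y_{i+1} (1 <= i <= k), y_{k+1} |-> t y_1 *)
Definition gamma k (F : V K k.+1) : V K k.+1 :=
  substV (@scalV k.+1) (@psumV k.+1)
    (fun i => if (i <= k)%N then yv k.+1 i.+1 else scalV k.+1 t * yv k.+1 1) F.

Definition dplus_star k (F : V K k) : V K k.+1 := gamma (shiftX F).

(* z_1 on V_{k+1} *)
Definition z1 k (F : V K k.+1) : V K k.+1 :=
  let G := foldl (fun G i => Tinv i G) F (iota 1 k) in
  scalV k.+1 (q ^+ k / (q^-1 - 1))
    * (dplus_star (dminus G) - dminus (dplus_star G)).

(* z_i on V_{k+1}, for 1 <= i <= k+1 *)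
Fixpoint zop k (i : nat) (F : V K k.+1) : V K k.+1 :=
  match i with
  | 0 | 1 => z1 F
  | (i'.+1 as i1).+1 => scalV k.+1 q^-1 * Top i1 (zop i1 (Top i1 F))
  end.

(* d^m(1), with 1 in V_0 *)
Fixpoint iter1 (d : forall k, V K k -> V K k.+1) (m : nat) : V K m :=
  if m is m'.+1 then d m' (iter1 d m') else 1.

End Operators.


Section Algebra.
Variable K : fieldType.

(* K-linear combinations of paths from vertex i to vertex j: the (syntactic)
   elements of e_j A e_i. *)
Inductive expr : nat -> nat -> Type :=
| Ge k : expr k k
| Gdp k : expr k k.+1
| Gdm k : expr k.+1 k
| GT k i (h : (0 < i < k)%N) : expr k k
| Eadd i j (a b : expr i j) : expr i j
| Escale i j (c : K) (a : expr i j) : expr i j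
| Emul i j l (a : expr j l) (b : expr i j) : expr i l.

Declare Scope expr_scope.
Delimit Scope expr_scope with E.
Local Infix "+" := Eadd : expr_scope.
Local Infix "*:" := Escale : expr_scope.
(* products are composed right to left *)
Local Infix "*" := Emul : expr_scope.
Local Notation "a - b" := (Eadd a (Escale (-1) b)) : expr_scope.

(* d_+ d_- - d_- d_+ at vertex k+1 *)
Definition Ecomm k : expr k.+1 k.+1 := (Gdp k * Gdm k - Gdm k.+1 * Gdp k.+1)%E.

(* The defining relations of A_r.  T_i only exists at the vertices k > i, and
   d_- only starts from the vertices k+1. *)
Inductive defrel (r : K) : forall i j, expr i j -> expr i j -> Prop :=
| R_quad k i (h : (0 < i < k)%N) :
    defrel r ((GT h - Ge k) * (GT h + r *: Ge k))%E (0 *: Ge k)%E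
| R_braid k i (h : (0 < i < k)%N) (h' : (0 < i.+1 < k)%N) :
    defrel r (GT h * GT h' * GT h)%E (GT h' * GT h * GT h')%E
| R_far k i j (h : (0 < i < k)%N) (h' : (0 < j < k)%N) :
    (i.+1 < j)%N || (j.+1 < i)%N -> defrel r (GT h * GT h')%E (GT h' * GT h)%E
| R_Tdm k i (h : (0 < i < k)%N) (h' : (0 < i < k.+1)%N) :
    defrel r (GT h * Gdm k)%E (Gdm k * GT h')%E
| R_dpT k i (h : (0 < i < k)%N) (h' : (0 < i.+1 < k.+1)%N) :
    defrel r (Gdp k * GT h)%E (GT h' * Gdp k)%E
| R_Tdp2 k (h : (0 < 1 < k.+2)%N) :
    defrel r (GT h * (Gdp k.+1 * Gdp k))%E (Gdp k.+1 * Gdp k)%E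
| R_dm2T k (h : (0 < k.+1 < k.+2)%N) :
    defrel r ((Gdm k * Gdm k.+1) * GT h)%E (Gdm k * Gdm k.+1)%E
| R_dmcomm k (h : (0 < k.+1 < k.+2)%N) :
    defrel r (Gdm k.+1 * Ecomm k.+1 * GT h)%E (r *: (Ecomm k * Gdm k.+1))%E
| R_commdp k (h : (0 < 1 < k.+2)%N) :
    defrel r (GT h * Ecomm k.+1 * Gdp k.+1)%E (r *: (Gdp k.+1 * Ecomm k))%E.

(* Equality in A_r: the smallest congruence containing the axioms of a
   K-algebra with local units e_k and the defining relations. *)
Inductive aeq (r : K) : forall i j, expr i j -> expr i j -> Prop :=
| Q_rel i j (a b : expr i j) : defrel r a b -> aeq r a b
| Q_refl i j (a : expr i j) : aeq r a a
| Q_sym i j (a b : expr i j) : aeq r a b -> aeq r b a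
| Q_trans i j (a b c : expr i j) : aeq r a b -> aeq r b c -> aeq r a c
| Q_add i j (a a' b b' : expr i j) :
    aeq r a a' -> aeq r b b' -> aeq r (a + b)%E (a' + b')%E
| Q_scale i j c (a a' : expr i j) : aeq r a a' -> aeq r (c *: a)%E (c *: a')%E
| Q_mul i j l (a a' : expr j l) (b b' : expr i j) :
    aeq r a a' -> aeq r b b' -> aeq r (a * b)%E (a' * b')%E
| Q_addA i j (a b c : expr i j) : aeq r (a + (b + c))%E (a + b + c)%E
| Q_addC i j (a b : expr i j) : aeq r (a + b)%E (b + a)%E
| Q_add0 i j (a b : expr i j) : aeq r (a + 0 *: b)%E a
| Q_scale1 i j (a : expr i j) : aeq r (1 *: a)%E a
| Q_scaleA i j c d (a : expr i j) : aeq r (c *: (d *: a))%E ((c * d)%R *: a)%E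
| Q_scaleDr i j c (a b : expr i j) : aeq r (c *: (a + b))%E (c *: a + c *: b)%E
| Q_scaleDl i j c d (a : expr i j) :
    aeq r ((c + d)%R *: a)%E (c *: a + d *: a)%E
| Q_mulA i j l m (a : expr l m) (b : expr j l) (c : expr i j) :
    aeq r (a * (b * c))%E (a * b * c)%E
| Q_mul1l i j (a : expr i j) : aeq r (Ge j * a)%E a
| Q_mul1r i j (a : expr i j) : aeq r (a * Ge i)%E a
| Q_mulDl i j l (a b : expr j l) (c : expr i j) :
    aeq r ((a + b) * c)%E (a * c + b * c)%E
| Q_mulDr i j l (a : expr j l) (b c : expr i j) :
    aeq r (a * (b + c))%E (a * b + a * c)%E
| Q_scaleAl i j l c (a : expr j l) (b : expr i j) :
    aeq r ((c *: a) * b)%E (c *: (a * b))%E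
| Q_scaleAr i j l c (a : expr j l) (b : expr i j) :
    aeq r (a * (c *: b))%E (c *: (a * b))%E.

(* An action of A_r on V_*, the direct sum of the V_k, in which e_k is the
   projection to V_k: an element of e_j A_r e_i vanishes on V_l for l <> i and
   maps V_i to V_j, so the action amounts to K-linear maps V_i -> V_j, linear
   and multiplicative in the element of e_j A_r e_i. *)
Record is_action (r : K) (act : forall i j, expr i j -> V K i -> V K j) : Prop :=
  IsAction {
    act_wd : forall i j (a b : expr i j), aeq r a b -> act i j a =1 act i j b;
    act_linear : forall i j (a : expr i j) c (F G : V K i),
      act i j a (scalV i c * F + G) = scalV j c * act i j a F + act i j a G;
    act_add : forall i j (a b : expr i j) F,
      act i j (a + b)%E F = act i j a F + act i j b F;
    act_scale : forall i j c (a : expr i j) F,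
      act i j (c *: a)%E F = scalV j c * act i j a F;
    act_mul : forall i j l (a : expr j l) (b : expr i j) F,
      act i l (a * b)%E F = act j l a (act i j b F);
    act_e : forall k F, act k k (Ge k) F = F
  }.

End Algebra.

Arguments Ge K k : clear implicits.
Arguments Gdp K k : clear implicits.
Arguments Gdm K k : clear implicits.
Arguments GT K {k i} h.

(* Main.v *)
(* The operator d_- is a residue: with u = z^{-1},
     d_- F = - [u^{-1}] F[X - (q-1) u; y_k = u] Exp[-X/u],
   where F[X - (q-1) u; y_k = u] is the image of F under a ring homomorphism to
   V_{k-1}[u].  Since Exp[-(q-1) a / u] = (u - q a) / (u - a), all compositions
   of d_-, d_+^* and the substitutions X -> X + (q-1) y become residues of
   explicit kernels.  In particular, with a = t y_1,
     (d_+^* d_- - d_- d_+^* ) F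
       = (q-1) a [u^0] F[X + (q-1)(a - u); y_2, .., y_k, u] Exp[(a - X)/u],
   so that z_1 d_+ is immediate.  The quadratic relations with T reduce, through
   T_i = 1 + (y_{i+1} - q y_i) (s_i - 1) / (y_{i+1} - y_i), to the vanishing of
   the double residue of an antisymmetric function against a symmetric kernel;
   z_{i+1} d_+ = d_+ z_i follows from the case i = 1 by the braid relations. *)

From HB Require Import structures.
Require Import Defs.
From mathcomp Require Import all_boot all_order all_algebra finmap.
From mathcomp.multinomials Require Import monalg.
From mathcomp.multinomials Require Import mpoly.
From mathcomp Require Import ring zify.
From Stdlib Require Import ClassicalEpsilon.

Set Implicit Arguments.
Unset Strict Implicit.
Unset Printing Implicit Defensive.

Import GRing.Theory.
Local Open Scope ring_scope.

(** The residues involve series in 1/u over polynomial rings, where a fraction such as (u - q a)/(u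
    - a) has no direct meaning. Hence a kernel is a bare sequence of coefficients, a residue is the
    finite sum [pairing], and an identity between quotients is stated with denominators multiplied
    out and used by cancelling factors of constant term 1. The maps s_i, F[X + (q-1) y], d_+^* and
    the substitution inside d_- are ring homomorphisms, so identities between them are checked on
    scalars, p_n and y_i. Their effect on Exp[-X/u] follows from their effect on the p_n, because in
    characteristic 0 Newton's recursion determines h_n[-X]. T_i and its inverse are chosen by
    [epsilon]: the quotient must first be shown to exist, and T_i is then computed after
    multiplication by the regular element y_{i+1} - y_i. The relations of the algebra with parameter
    1/q concern T_i^{-1}; each is proved for T_i and inverted at the end. The case i = 1 of z_{i+1}
    d_+ = d_+ z_i needs one further residue computation, the commutation of the commutator of d_+^*
    and d_- with F[X + (q-1) y] in the presence of one T. *)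

Section Generators.

(** * Generators of Sym[X] and V_k *)

Variable K : fieldType.

HB.instance Definition _ := GRing.RMorphism.copy (@symC K)
  (@mkmalgU {cmonom nat} K (@monalg.mone {cmonom nat})).
HB.instance Definition _ k := GRing.RMorphism.copy (@symV K k)
  (@mpolyC k (Sym K)).
HB.instance Definition _ k := GRing.RMorphism.copy (@scalV K k)
  (@symV K k \o @symC K).

Lemma malgUM (c : K) (m1 m2 : {cmonom nat}) :
  << c *g m1 >>%R * << m2 >> = << c *g (mulcm m1 m2) >> :> Sym K.
Proof. by rewrite malgM_def fgmulUU mulr1. Qed.

Lemma Sym_ind (P : Sym K -> Prop) :
  (forall c, P (symC c)) -> (forall n, (0 < n)%N -> P (psum K n)) ->
  (forall F G, P F -> P G -> P (F + G)) ->
  (forall F G, P F -> P G -> P (F * G)) -> forall F, P F.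
Proof.
move=> PC Pp PD PM F.
have P0 : P 0 by have := PC 0; rewrite rmorph0.
(* Induction on the degree: a nonconstant monomial is a smaller one times a variable of index [i],
   which is p_{i+1}. *)
have PU c m : P (<< c *g m >>).
  have [n] := ubnP (monalg.mdeg m); elim: n m => // n IHn m.
  rewrite ltnS => le_mn.
  have [m0|[i mi]] := fset_0Vmem (finsupp m).
    suff -> : m = onecm nat by exact: PC.
    apply/eqP/cmP => i; rewrite onecmE; apply/eqP.
    by rewrite monalg.cmE_eq0 m0 in_fset0.
  have Em : m = mulcm (divcm m (ucm i)) (ucm i).
    apply/eqP/cmP=> j; rewrite mulcmE divcmE ucmE subnK //.
    by case: eqP => [<-|//]; rewrite lt0n monalg.cmE_neq0.
  rewrite Em -malgUM; apply: PM (Pp i.+1 _) => //.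
  apply: IHn; apply: leq_trans le_mn; rewrite [in X in (_ < X)%N]Em.
  by rewrite (monalg.mdegM (divcm m (ucm i)) (ucm i)) monalg.mdegU addn1.
rewrite [F]monalgE; elim/big_ind: _ => // i _; exact: PU.
Qed.

(** Ring homomorphisms from V_k are compared on these generators. The condition [0 < n] excludes
    p_0, whose encoding through [n.-1] would coincide with p_1. *)
Lemma V_ind k (P : V K k -> Prop) :
  (forall c, P (scalV k c)) -> (forall n, (0 < n)%N -> P (psumV K k n)) ->
  (forall i, (0 < i <= k)%N -> P (yv K k i)) ->
  (forall F G, P F -> P G -> P (F + G)) ->
  (forall F G, P F -> P G -> P (F * G)) -> forall F, P F.
Proof.
move=> PC Pp Py PD PM F.
have Psym G : P (symV k G).
  elim/Sym_ind: G => [c|n n0|G1 G2 h1 h2|G1 G2 h1 h2]; [exact: PC | exact: Pp | |].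
    by rewrite rmorphD; exact: PD.
  by rewrite rmorphM; exact: PM.
have P1 : P 1 by have := PC 1; rewrite rmorph1.
elim/mpolyind: F => [|c m p _ _ Pp']; first by have := PC 0; rewrite rmorph0.
apply: PD => //; rewrite -mul_mpolyC; apply: (PM); first exact: Psym.
rewrite mpolyXE_id; apply: (big_ind P) => [||i _]; [exact: P1 | exact: (PM) |].
have PX : P ('X_i : mpoly k (Sym K)).
  have := Py i.+1 _; rewrite /yv (big_pred1 i); first by apply; exact: (ltn_ord i).
  by move=> j; rewrite /= eqSS.
by elim: (m i) => [|n IHn]; rewrite ?expr0 // exprS; exact: PM.
Qed.

End Generators.

Lemma yvE (K : fieldType) k (i : 'I_k) : yv K k i.+1 = 'X_i.
Proof. by rewrite /yv (big_pred1 i) // => j; rewrite /= eqSS. Qed.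

(** * Plethystic substitutions as ring homomorphisms *)

Section Substitution.
Variables (K : fieldType) (B : comNzRingType).

(** The monomial map inside [pleth], named so that it can carry the multiplicativity that makes
    [pleth] a ring homomorphism. *)
Definition pow_monom (a : nat -> B) (m : {cmonom nat}) : B :=
  \prod_(i <- finsupp (m : {fsfun nat -> nat with 0%N})) a i.+1 ^+ m i.

Lemma pow_monomEw a (d : {fset nat}) (m : {cmonom nat}) :
  (finsupp m `<=` d)%fset -> pow_monom a m = \prod_(i <- d) a i.+1 ^+ m i.
Proof.
move=> le; rewrite /pow_monom (big_fset_incl _ le) //= => i _.
by rewrite -monalg.cmE_eq0 => /eqP ->.
Qed.

Lemma pow_monom_morph a : monalg.mmorphism (pow_monom a).
Proof.
split=> [m1 m2|]; last by rewrite /pow_monom monalg.mdom1 big_nil.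
rewrite !(@pow_monomEw a (finsupp m1 `|` finsupp m2)%fset);
  rewrite ?fsubsetUl ?fsubsetUr ?monalg.mdomD //.
by rewrite -big_split; apply: eq_bigr => i _ /=; rewrite monalg.cmM exprD.
Qed.

HB.instance Definition _ a :=
  monalg.isMultiplicative.Build _ _ (pow_monom a) (pow_monom_morph a).

Variables (c : {rmorphism K -> B}) (a b : nat -> B).

HB.instance Definition _ :=
  GRing.RMorphism.copy (@pleth K B c a) (monalg.mmap c (pow_monom a)).

Lemma pleth_symC x : pleth c a (symC x) = c x.
Proof. exact: (@monalg.mmapC {cmonom nat} K B c (pow_monom a)). Qed.

Lemma pleth_psum n : (0 < n)%N -> pleth c a (psum K n) = a n.
Proof.
case: n => // n _; rewrite /pleth /psum monalg.mmapU /= rmorph1 mul1r.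
by rewrite monalg.mdomU big_seq_fset1 monalg.cmUU.
Qed.

HB.instance Definition _ k :=
  GRing.RMorphism.copy (@substV K k B c a b)
    (mpoly.mmap (pleth c a) (fun j : 'I_k => b j.+1)).

Lemma substV_scal k x : substV c a b (scalV k x) = c x.
Proof. by rewrite /substV mpoly.mmapC /= pleth_symC. Qed.

Lemma substV_psum k n : (0 < n)%N -> substV c a b (psumV K k n) = a n.
Proof. by move=> n0; rewrite /substV mpoly.mmapC /= pleth_psum. Qed.

Lemma substV_y k i : (0 < i <= k)%N -> substV c a b (yv K k i) = b i.
Proof.
case: i => // i /= ik; rewrite -[i]/(nat_of_ord (Ordinal ik)) yvE.
by rewrite /substV mpoly.mmapX mpoly.mmap1U.
Qed.

End Substitution.

Section Operators.
Variables (K : fieldType) (q t : K).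

HB.instance Definition _ k i := GRing.RMorphism.copy (@sop K k i)
  (substV (@scalV K k) (@psumV K k) (fun j => yv K k (swap_index i j))).

HB.instance Definition _ k := GRing.RMorphism.copy (@shiftX K q k)
  (substV (@scalV K k.+1)
    (fun n => psumV K k.+1 n + scalV k.+1 (q ^+ n - 1) * yv K k.+1 k.+1 ^+ n)
    (yv K k.+1)).

HB.instance Definition _ k := GRing.RMorphism.copy (@gamma K t k)
  (substV (@scalV K k.+1) (@psumV K k.+1)
    (fun i => if (i <= k)%N then yv K k.+1 i.+1 else scalV k.+1 t * yv K k.+1 1)).

HB.instance Definition _ k := GRing.RMorphism.copy (@dplus_star K q t k)
  (@gamma K t k \o @shiftX K q k).

HB.instance Definition _ k := GRing.RMorphism.copy (@shiftZ K q k)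
  (substV (polyC \o @scalV K k)
    (fun n => (psumV K k n)%:P - (scalV k (q ^+ n - 1))%:P * 'X^n)
    (fun i => (yv K k i)%:P)).

(* F[X - (q-1) u] with y_{k+1} replaced by u, where u is ['X] *)
Definition shiftY k (F : V K k.+1) : {poly V K k} :=
  (map_poly (@shiftZ K q k) (muni F)).['X].

HB.instance Definition _ k := GRing.RMorphism.copy (@shiftY k)
  (horner_eval 'X \o map_poly (@shiftZ K q k) \o
     (@muni k (Sym K) : {rmorphism V K k.+1 -> {poly V K k}})).
End Operators.

(** * Cancellation of differences of the y_i *)

Section Regular.
Variable K : fieldType.

(** The leading coefficient is 1 or -1, whichever variable the monomial order puts first, hence
    regular over any coefficient ring. *)
Lemma mpolyX_sub_rreg (R : comNzRingType) k (i j : 'I_k) : i != j ->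
  GRing.rreg ('X_j - 'X_i : mpoly.mpoly k R).
Proof.
move=> ij; set p := 'X_j - 'X_i.
have coefp m : p@_m = (U_(j)%MM == m)%:R - (U_(i)%MM == m)%:R.
  by rewrite mcoeffB !mcoeffX.
have p0 : p != 0.
  apply/eqP => p0; have := coefp U_(j)%MM; rewrite p0 mcoeff0 eqxx eq_mnm1.
  by rewrite (negbTE ij) subr0 => /eqP; rewrite eq_sym oner_eq0.
suff h : GRing.lreg p by move=> a b; rewrite !(mulrC _ p) => /h.
apply: lreg_mleadc; have := mlead_supp p0.
rewrite mcoeff_msupp coefp; move: (mlead p) => m.
case: (_ == m); case: (_ == m); rewrite ?subrr ?eqxx ?subr0 ?sub0r // => _.
  exact: lreg1.
by apply/lregN; exact: lreg1.
Qed.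

Lemma yv_sub_rreg k i j : (0 < i <= k)%N -> (0 < j <= k)%N -> i != j ->
  GRing.rreg (yv K k j - yv K k i).
Proof.
case: i j => [|i] [|j] ik jk ij; try by exfalso; lia.
have -> : yv K k j.+1 = 'X_(Ordinal jk) by exact: (yvE K (Ordinal jk)).
have -> : yv K k i.+1 = 'X_(Ordinal ik) by exact: (yvE K (Ordinal ik)).
exact: mpolyX_sub_rreg.
Qed.
End Regular.

(* The coefficient of u^0 in [P(u) * \sum_n h n u^{-n}] *)
Definition pairing (R : comNzRingType) (h : nat -> R) (P : {poly R}) : R :=
  \sum_(i < size P) P`_i * h i.

(** * Power series as coefficient sequences, and residues *)

Section GeneratingSeries.
Variable R : comNzRingType.
Implicit Types (h : nat -> R) (a c : R) (P Q : {poly R}).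

(** Multiplication of the series by z. In a pairing z is 1/u, so a shifted kernel extracts the
    coefficient of u^1 instead of u^0. *)
Definition seq_shift h n : R := if n is m.+1 then h m else 0.

(* [seq_mul c] and [seq_div c] multiply and divide the series
   [\sum_n h n z^n] by [1 - c z]. *)
Definition seq_mul c h n : R := h n - c * seq_shift h n.

Fixpoint seq_div c h n : R :=
  if n is m.+1 then h n + c * seq_div c h m else h 0.

Lemma eq_seq_shift h h' : h =1 h' -> seq_shift h =1 seq_shift h'.
Proof. by move=> e [|n] /=. Qed.

Lemma eq_seq_mul c h h' : h =1 h' -> seq_mul c h =1 seq_mul c h'.
Proof. by move=> e n; rewrite /seq_mul e (eq_seq_shift e). Qed.

Lemma seq_mulC a c h : seq_mul a (seq_mul c h) =1 seq_mul c (seq_mul a h).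
Proof. by case=> [|n]; rewrite /seq_mul /=; ring. Qed.

(** The constant term of 1 - c z is 1, so the factor cancels over any ring. This replaces all
    division of kernels. *)
Lemma seq_mul_inj c h h' : seq_mul c h =1 seq_mul c h' -> h =1 h'.
Proof.
move=> e; elim=> [|n IHn]; first by have := e 0; rewrite /seq_mul /= !mulr0 !subr0.
by have := e n.+1; rewrite /seq_mul /= IHn => /addIr.
Qed.

Lemma seq_divK c h : seq_mul c (seq_div c h) =1 h.
Proof. by case=> [|n]; rewrite /seq_mul /=; ring. Qed.

Lemma eq_pairing h h' : h =1 h' -> pairing h =1 pairing h'.
Proof. by move=> e P; apply: eq_bigr => i _; rewrite e. Qed.

Lemma pairing_widen h P n : (size P <= n)%N ->
  pairing h P = \sum_(i < n) P`_i * h i.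
Proof.
move=> le; rewrite /pairing (big_ord_widen n (fun i => P`_i * h i)) //.
rewrite big_mkcond; apply: eq_bigr => i _; case: ltnP => // leP.
by rewrite nth_default // mul0r.
Qed.

Lemma pairingD h P Q : pairing h (P + Q) = pairing h P + pairing h Q.
Proof.
have leP := leq_maxl (size P) (size Q); have leQ := leq_maxr (size P) (size Q).
rewrite !(@pairing_widen h _ (maxn (size P) (size Q))) ?size_polyD //.
by rewrite -big_split; apply: eq_bigr => i _; rewrite coefD mulrDl.
Qed.

Lemma pairing_CM h a P : pairing h (a%:P * P) = a * pairing h P.
Proof.
rewrite (@pairing_widen _ _ (size P)); last by rewrite mul_polyC size_scale_leq.
by rewrite /pairing mulr_sumr; apply: eq_bigr => i _; rewrite coefCM mulrA.
Qed.

Lemma pairingN h P : pairing h (- P) = - pairing h P.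
Proof. by rewrite -mulN1r -polyC1 -polyCN pairing_CM mulN1r. Qed.

Lemma pairingB h P Q : pairing h (P - Q) = pairing h P - pairing h Q.
Proof. by rewrite pairingD pairingN. Qed.

Lemma pairing_C h a : pairing h a%:P = a * h 0.
Proof. by rewrite (@pairing_widen _ _ 1) ?size_polyC_leq1 // big_ord1 coefC. Qed.

Lemma pairing_XM h P : pairing h ('X * P) = pairing (fun n => h n.+1) P.
Proof.
rewrite (@pairing_widen _ _ (size P).+1); last first.
  by apply: leq_trans (size_polyMleq _ _) _; rewrite size_polyX.
rewrite big_ord_recl coefXM /= mul0r add0r.
by apply: eq_bigr => i _; rewrite coefXM.
Qed.

Lemma pairing_shift_XM h P : pairing (seq_shift h) ('X * P) = pairing h P.
Proof. by rewrite pairing_XM. Qed.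

Lemma pairing_shift_C h a : pairing (seq_shift h) a%:P = 0.
Proof. by rewrite pairing_C mulr0. Qed.

Lemma pairing_seq_mul c h P :
  pairing (seq_mul c h) P = pairing h P - c * pairing (seq_shift h) P.
Proof.
rewrite /pairing mulr_sumr -sumrB; apply: eq_bigr => i _.
by rewrite /seq_mul; ring.
Qed.

Lemma pairing_seq_mul_shift c h P :
  pairing (seq_mul c h) P = pairing (seq_shift h) (('X - c%:P) * P).
Proof.
by rewrite pairing_seq_mul mulrBl pairingB pairing_shift_XM pairing_CM.
Qed.

(** As u (1 - c/u) = u - c, a factor of the kernel moves into the polynomial by using up the factor
    u that comes with d_-. *)
Lemma pairing_seq_mul_X c h P :
  pairing (seq_mul c h) ('X * P) = pairing h (('X - c%:P) * P).
Proof. by rewrite pairing_seq_mul_shift mulrCA pairing_shift_XM. Qed.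

End GeneratingSeries.

(** * Double residues against a symmetric kernel *)

Section DoublePairing.
Variable R : comNzRingType.

Lemma pairing2E (h : nat -> R) (A : {poly {poly R}}) n : (size A <= n)%N ->
  (forall i, size (A`_i)%R <= n)%N ->
  pairing h (pairing (polyC \o h) A)
  = \sum_(i < n) \sum_(j < n) A`_i`_j * (h i * h j).
Proof.
move=> leA leAi; rewrite (pairing_widen _ leA).
have {leA} -> : forall r : seq 'I_n, pairing h (\sum_(i <- r) A`_i * (polyC \o h) i)
    = \sum_(i <- r) pairing h (A`_i * (polyC \o h) i).
  elim=> [|i r IHr]; rewrite ?big_nil ?big_cons ?pairingD ?IHr //.
  by rewrite -polyC0 pairing_C mul0r.
apply: eq_bigr => i _; rewrite /= mulrC pairing_CM (pairing_widen _ (leAi i)).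
by rewrite mulr_sumr; apply: eq_bigr => j _; ring.
Qed.

(** The kernel h(u) h(v) is symmetric. The lemma serves to annihilate differences [swapXY A - A],
    which needs no division by 2. *)
Lemma pairing2_swapXY (h : nat -> R) (A : {poly {poly R}}) :
  pairing h (pairing (polyC \o h) (swapXY A)) = pairing h (pairing (polyC \o h) A).
Proof.
pose n := maxn (size A) (sizeY A).
have leA : (size A <= n)%N by exact: leq_maxl.
have leAi i : (size (A`_i)%R <= n)%N.
  by apply: leq_trans (leq_maxr _ _); exact: max_size_coefXY.
rewrite !(@pairing2E h _ n) //.
- rewrite exchange_big; apply: eq_bigr => i _; apply: eq_bigr => j _.
  by rewrite coef_swapXY [h j * _]mulrC.
- apply/leq_sizeP => i le_i; apply/polyP => j; rewrite coef_swapXY coef0.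
  by rewrite nth_default // (leq_trans (leAi j)).
- move=> i; apply/leq_sizeP => j le_j; rewrite coef_swapXY.
  by rewrite (nth_default 0 (leq_trans leA le_j)) coef0.
Qed.

End DoublePairing.

(** * Newton's recursion *)

Section Newton.
Variable R : comNzRingType.
Implicit Types (p h : nat -> R) (c : R).

(** The coefficientwise form of h(z) = exp(- (p_1 z + p_2 z^2 / 2 + ...)), the series Exp[-zX];
    [p 0] does not enter. *)
Definition newton (p h : nat -> R) :=
  h 0 = 1 /\
  forall n, n.+1%:R * h n.+1 = - \sum_(i < n.+1) p i.+1 * h (n - i)%N.

(** 1 - c z is the exponential of - (c z + c^2 z^2 / 2 + ...), so multiplying by it adds c^i to
    p_i. *)
Lemma newton_seq_mul p h c : newton p h ->
  newton (fun i => p i + c ^+ i) (seq_mul c h).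
Proof.
case=> h0 hS; split=> [|n]; first by rewrite /seq_mul /= mulr0 subr0.
have tel m : \sum_(i < m.+1) c ^+ i.+1 * seq_mul c h (m - i)%N = c * h m.
  elim: m => [|m IHm].
    by rewrite big_ord1 expr1 /seq_mul /= mulr0 subr0.
  rewrite big_ord_recl /= expr1 subn0.
  under eq_bigr => i _ do rewrite /bump add1n exprS subSS -mulrA.
  by rewrite -mulr_sumr IHm /seq_mul /=; ring.
(* The recursion one index lower; the vanishing last term of the shifted sequence makes it valid for
   n = 0 as well. *)
have hn : n%:R * h n = - \sum_(i < n.+1) p i.+1 * seq_shift h (n - i)%N.
  rewrite big_ord_recr /= subnn /= mulr0 addr0.
  case: n => [|n]; first by rewrite mul0r big_ord0 oppr0.
  rewrite hS; congr (- _); apply: eq_bigr => i _.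
  by rewrite subSn // -ltnS.
under eq_bigr => i _ do rewrite mulrDl {1}/seq_mul mulrBr mulrCA.
rewrite big_split /= tel sumrB -mulr_sumr.
have -> : n.+1%:R * seq_mul c h n.+1 =
    n.+1%:R * h n.+1 - c * (n%:R * h n) - c * h n.
  by rewrite /seq_mul /= -natr1; ring.
by rewrite hS hn; ring.
Qed.

Lemma newton_uniq p p' h h' : (forall n, GRing.lreg (n.+1%:R : R)) ->
  (forall n, (0 < n)%N -> p n = p' n) -> newton p h -> newton p' h' -> h =1 h'.
Proof.
move=> reg ep [h0 hS] [h'0 h'S] n.
have [m] := ubnP n; elim: m n => // m IHm [|n]; first by rewrite h0 h'0.
rewrite ltnS => lt_nm; apply: (reg n); rewrite hS h'S; congr (- _).
apply: eq_bigr => i _; rewrite ep // IHm //.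
by apply: leq_ltn_trans lt_nm; exact: leq_subr.
Qed.

End Newton.

Section MorphismSeries.
Variables (R S : comNzRingType) (f : {rmorphism R -> S}).

Lemma rmorph_seq_shift h : f \o seq_shift h =1 seq_shift (f \o h).
Proof. by case=> [|n] //=; rewrite rmorph0. Qed.

Lemma rmorph_seq_mul c h : f \o seq_mul c h =1 seq_mul (f c) (f \o h).
Proof.
by move=> n; rewrite /= rmorphB rmorphM -/((f \o seq_shift h) n) rmorph_seq_shift.
Qed.

Lemma rmorph_pairing h P : f (pairing h P) = pairing (f \o h) (map_poly f P).
Proof.
rewrite (@pairing_widen _ _ (map_poly f P) (size P)) ?size_poly // rmorph_sum.
by apply: eq_bigr => i _; rewrite rmorphM coef_map.
Qed.

Lemma rmorph_newton p h : newton p h -> newton (f \o p) (f \o h).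
Proof.
case=> h0 hS; split=> [|n] /=; first by rewrite h0 rmorph1.
rewrite -(rmorph_nat f) -rmorphM hS rmorphN rmorph_sum.
by congr (- _); apply: eq_bigr => i _; rewrite rmorphM.
Qed.
End MorphismSeries.

Lemma pairing_MXn (R : comNzRingType) (h : nat -> R) (P : {poly R}) i :
  pairing h (P * 'X^i) = pairing (fun n => h (i + n)%N) P.
Proof.
elim: i h => [|i IHi] h; first by rewrite expr0 mulr1.
rewrite exprSr mulrA -[_ * 'X]mulrC pairing_XM IHi.
by apply: eq_pairing => n; rewrite addSn.
Qed.

Lemma pairing_sum (R : comNzRingType) (h : nat -> R) n (P : 'I_n -> {poly R}) :
  pairing h (\sum_(i < n) P i) = \sum_(i < n) pairing h (P i).
Proof.
apply: (big_morph (pairing h)) => [P1 P2|]; first exact: pairingD.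
by rewrite -polyC0 pairing_C mul0r.
Qed.

(** * The braid relation for Demazure-Lusztig operators, over an abstract ring *)

Section BraidRelation.
Variables (R : comNzRingType) (q x y z : R) (s1 s2 : {rmorphism R -> R}).
Variables (T1 T2 : R -> R).
Hypotheses (s1q : s1 q = q) (s1x : s1 x = y) (s1y : s1 y = x) (s1z : s1 z = z).
Hypotheses (s2q : s2 q = q) (s2x : s2 x = x) (s2y : s2 y = z) (s2z : s2 z = y).
Hypotheses (s1K : forall F, s1 (s1 F) = F) (s2K : forall F, s2 (s2 F) = F).
Hypothesis s_braid : forall F, s1 (s2 (s1 F)) = s2 (s1 (s2 F)).
Hypothesis T1E : forall F, T1 F * (y - x) = (q - 1) * x * F + (y - q * x) * s1 F.
Hypothesis T2E : forall F, T2 F * (z - y) = (q - 1) * y * F + (z - q * y) * s2 F.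
Hypotheses (yx_reg : GRing.rreg (y - x)) (zy_reg : GRing.rreg (z - y)).
Hypothesis zx_reg : GRing.rreg (z - x).

(** Both sides are combinations of the six images of F under the symmetric group on x, y, z. After
    clearing denominators the coefficients agree as polynomials. *)
Lemma Hecke_braid F : T1 (T2 (T1 F)) = T2 (T1 (T2 F)).
Proof.
(* A common denominator: s1 and s2 turn the divisors y - x and z - y of the inner operators into z -
   x or, up to sign, into themselves. *)
apply: yx_reg; apply: yx_reg; apply: zy_reg; apply: zy_reg; apply: zx_reg.
have image_s1 G H (e : G = H) : s1 G = s1 H by rewrite e.
have image_s2 G H (e : G = H) : s2 G = s2 H by rewrite e.
have simp := (rmorphM, rmorphD, rmorphN, rmorph1, s1q, s1x, s1y, s1z,
              s2q, s2x, s2y, s2z, s1K, s2K).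
have -> : T1 (T2 (T1 F)) * (y - x) * (y - x) * (z - y) * (z - y) * (z - x)
    = T1 (T2 (T1 F)) * (y - x) * ((y - x) * (z - y) * (z - x)) * (z - y) by ring.
have -> : T2 (T1 (T2 F)) * (y - x) * (y - x) * (z - y) * (z - y) * (z - x)
    = T2 (T1 (T2 F)) * (z - y) * ((y - x) * (z - y) * (z - x)) * (y - x) by ring.
rewrite T1E T2E.
(* The defining equations and their images under s1 and s2 are all that is needed; the images are
   then generalized to independent variables. *)
have hA := T1E F; have hA' := T2E F.
have ha1 := image_s1 _ _ hA; have ha2 := image_s2 _ _ hA.
have ha1' := image_s1 _ _ hA'; have ha2' := image_s2 _ _ hA'.
have ha12 := image_s1 _ _ ha2; have ha21' := image_s2 _ _ ha1'.
have hB := T2E (T1 F); have hB' := T1E (T2 F).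
have hb1 := image_s1 _ _ hB; have hb2' := image_s2 _ _ hB'.
rewrite !simp in ha1 ha2 ha1' ha2' ha12 ha21' hb1 hb2'.
move: hA hA' ha1 ha2 ha1' ha2' ha12 ha21' hB hB' hb1 hb2'; rewrite s_braid.
move: (T1 F) (T2 F) (T2 (T1 F)) (T1 (T2 F)) => A A' B B'.
move: (s1 A) (s2 A) (s1 A') (s2 A') (s1 B) (s2 B') (s1 (s2 A)) (s2 (s1 A')).
move=> a1 a2 a1' a2' b1 b2' a12 a21'.
move: (s1 F) (s2 F) (s1 (s2 F)) (s2 (s1 F)) (s2 (s1 (s2 F))).
move=> f1 f2 f12 f21 f121 hA hA' ha1 ha2 ha1' ha2' ha12 ha21' hB hB' hb1 hb2'.
have -> : ((q - 1) * x * B + (y - q * x) * b1)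
     * ((y - x) * (z - y) * (z - x)) * (z - y)
  = ((q - 1) * x * (B * (z - y)) * (y - x) * (z - x)
     + (y - q * x) * (b1 * (z - x)) * (y - x) * (z - y)) * (z - y) by ring.
have -> : ((q - 1) * y * B' + (z - q * y) * b2')
     * ((y - x) * (z - y) * (z - x)) * (y - x)
  = ((q - 1) * y * (B' * (y - x)) * (z - y) * (z - x)
     + (z - q * y) * (b2' * (z - x)) * (y - x) * (z - y)) * (y - x) by ring.
rewrite hB hb1 hB' hb2'.
have -> : ((q - 1) * x * ((q - 1) * y * A + (z - q * y) * a2) * (y - x) * (z - x)
     + (y - q * x) * ((q - 1) * x * a1 + (z - q * x) * a12) * (y - x) * (z - y))
  = (q - 1) * x * ((q - 1) * y * (A * (y - x)) * (z - x)
                   + (z - q * y) * (a2 * (z - x)) * (y - x))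
    + (y - q * x) * (- (q - 1) * x * (a1 * (x - y)) * (z - y)
                   + (z - q * x) * (a12 * (z - y)) * (y - x)) by ring.
have -> : ((q - 1) * y * ((q - 1) * x * A' + (y - q * x) * a1') * (z - y) * (z - x)
     + (z - q * y) * ((q - 1) * x * a2' + (z - q * x) * a21') * (y - x) * (z - y))
  = (q - 1) * y * ((q - 1) * x * (A' * (z - y)) * (z - x)
                   + (y - q * x) * (a1' * (z - x)) * (z - y))
    + (z - q * y) * (- (q - 1) * x * (a2' * (y - z)) * (y - x)
                   + (z - q * x) * (a21' * (y - x)) * (z - y)) by ring.
rewrite hA ha2 ha1 ha12 hA' ha1' ha2' ha21'; ring.
Qed.
End BraidRelation.

(* The interface through which the relations are proved: mV is V_k, mc, mp and my
   are the scalars, the p_n and the y_i, ms is s_i, mD is F |-> F[X + (q-1) y_{k+1}],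
   mdp is d_+^*, mS is F |-> F[X - (q-1) u; y_{k+1} = u], mH is h_n[-X], mdm is d_-.
   It hides the construction of V_k, which conversion would otherwise unfold. *)
Record model (K : fieldType) (q t : K) := Model {
  mV : nat -> comNzRingType;
  mc : forall k, {rmorphism K -> mV k};
  mp : forall k, nat -> mV k;
  my : forall k, nat -> mV k;
  ms : forall k, nat -> {rmorphism mV k -> mV k};
  mD : forall k, {rmorphism mV k -> mV k.+1};
  mdp : forall k, {rmorphism mV k -> mV k.+1};
  mS : forall k, {rmorphism mV k.+1 -> {poly mV k}};
  mH : forall k, nat -> mV k;
  mdm : forall k, mV k.+1 -> mV k;
  m_ind : forall k (P : mV k -> Prop),
    (forall a, P (mc k a)) -> (forall n, (0 < n)%N -> P (mp k n)) ->
    (forall i, (0 < i <= k)%N -> P (my k i)) ->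
    (forall F G, P F -> P G -> P (F + G)) ->
    (forall F G, P F -> P G -> P (F * G)) -> forall F, P F;
  my_rreg : forall k i j, (0 < i <= k)%N -> (0 < j <= k)%N -> i != j ->
    GRing.rreg (my k j - my k i);
  ms_c : forall k i a, ms k i (mc k a) = mc k a;
  ms_p : forall k i n, (0 < n)%N -> ms k i (mp k n) = mp k n;
  ms_y : forall k i j, (0 < j <= k)%N -> ms k i (my k j) = my k (swap_index i j);
  mD_c : forall k a, mD k (mc k a) = mc k.+1 a;
  mD_p : forall k n, (0 < n)%N ->
    mD k (mp k n) = mp k.+1 n + mc k.+1 (q ^+ n - 1) * my k.+1 k.+1 ^+ n;
  mD_y : forall k i, (0 < i <= k)%N -> mD k (my k i) = my k.+1 i;
  mdp_c : forall k a, mdp k (mc k a) = mc k.+1 a;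
  mdp_p : forall k n, (0 < n)%N ->
    mdp k (mp k n)
    = mp k.+1 n + mc k.+1 (q ^+ n - 1) * (mc k.+1 t * my k.+1 1) ^+ n;
  mdp_y : forall k i, (0 < i <= k)%N -> mdp k (my k i) = my k.+1 i.+1;
  mS_c : forall k a, mS k (mc k.+1 a) = (mc k a)%:P;
  mS_p : forall k n, (0 < n)%N ->
    mS k (mp k.+1 n) = (mp k n)%:P - (mc k (q ^+ n - 1))%:P * 'X^n;
  mS_y : forall k i, (0 < i <= k)%N -> mS k (my k.+1 i) = (my k i)%:P;
  mS_last : forall k, mS k (my k.+1 k.+1) = 'X;
  mH_0 : forall k, mH k 0 = 1;
  mH_S : forall k n, mc k n.+1%:R * mH k n.+1
    = - \sum_(i < n.+1) mp k i.+1 * mH k (n - i);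
  mdmE : forall k F, mdm F = - pairing (mH k) ('X * mS k F) }.

(** * The operators T_i: existence, Hecke relations, inverses *)

Section Hecke.
Variables (K : fieldType) (q t : K) (M : model q t).
Local Notation V := (mV M).
Local Notation c := (mc M).
Local Notation y := (my M).
Local Notation s := (ms M).

Lemma rmorph_model_eq k (B : comNzRingType) (f g : {rmorphism V k -> B}) :
  (forall a, f (c k a) = g (c k a)) ->
  (forall n, (0 < n)%N -> f (mp M k n) = g (mp M k n)) ->
  (forall i, (0 < i <= k)%N -> f (y k i) = g (y k i)) -> f =1 g.
Proof.
move=> hC hp hy; apply: m_ind => // F G hF hG.
  by rewrite !rmorphD hF hG.
by rewrite !rmorphM hF hG.
Qed.

Lemma swap_indexl i : swap_index i i = i.+1.
Proof. by rewrite /swap_index eqxx. Qed.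

Lemma swap_indexr i : swap_index i i.+1 = i.
Proof. by rewrite /swap_index gtn_eqF // eqxx. Qed.

Lemma swap_index_id i j : j != i -> j != i.+1 -> swap_index i j = j.
Proof. by rewrite /swap_index => /negbTE -> /negbTE ->. Qed.

Lemma swap_indexK i : involutive (swap_index i).
Proof. by move=> j; rewrite /swap_index; do !case: eqP; lia. Qed.

Lemma swap_index_bound k i j :
  (0 < i < k)%N -> (0 < j <= k)%N -> (0 < swap_index i j <= k)%N.
Proof. by rewrite /swap_index; do !case: eqP; lia. Qed.

Lemma ms_yl k i : (0 < i < k)%N -> s k i (y k i) = y k i.+1.
Proof. by move=> ik; rewrite ms_y ?swap_indexl //; lia. Qed.

Lemma ms_yr k i : (0 < i < k)%N -> s k i (y k i.+1) = y k i.
Proof. by move=> ik; rewrite ms_y ?swap_indexr //; lia. Qed.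

Lemma ms_y_id k i j : (0 < j <= k)%N -> j != i -> j != i.+1 ->
  s k i (y k j) = y k j.
Proof. by move=> jk ji ji'; rewrite ms_y ?swap_index_id. Qed.

Lemma msK k i : (0 < i < k)%N -> involutive (s k i).
Proof.
move=> ik; apply: (@rmorph_model_eq k _ (s k i \o s k i) idfun) => /=.
- by move=> a; rewrite !ms_c.
- by move=> n n0; rewrite !ms_p.
- by move=> j jk; rewrite !ms_y ?swap_indexK ?swap_index_bound.
Qed.

(** Twisted Leibniz rule: s(FG) - FG = s(F) (s(G) - G) + (s(F) - F) G, so divisibility passes from
    generators to products. *)
Lemma y_sub_s_dvd k i (F : V k) : (0 < i < k)%N ->
  exists G, G * (y k i.+1 - y k i) = s k i F - F.
Proof.
move=> ik; elim/m_ind: F => [a|n n0|j jk|F G [F' eF] [G' eG]|F G [F' eF] [G' eG]].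
- by exists 0; rewrite ms_c subrr mul0r.
- by exists 0; rewrite ms_p // subrr mul0r.
- have [->|ji] := eqVneq j i.
    by exists 1; rewrite ms_yl // mul1r.
  have [->|ji1] := eqVneq j i.+1.
    by exists (-1); rewrite ms_yr // mulN1r opprB.
  by exists 0; rewrite ms_y_id // subrr mul0r.
- by exists (F' + G'); rewrite mulrDl eF eG rmorphD; ring.
- exists (s k i F * G' + F' * G).
  have -> : forall D : V k, (s k i F * G' + F' * G) * D
    = s k i F * (G' * D) + F' * D * G by move=> D; ring.
  by rewrite eF eG rmorphM; ring.
Qed.

(** The divided difference (F - s_i F) / (y_i - y_{i+1}). *)
Definition ddiff k i (F : V k) : V k :=
  epsilon (inhabits 0) (fun G => G * (y k i.+1 - y k i) = s k i F - F).

(** The same [epsilon] term as in [Top], so that both are convertible in the concrete model. *)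
Definition mT k i (P : V k) : V k :=
  epsilon (inhabits 0) (fun C => C * (y k i.+1 - y k i) =
    c k (q - 1) * y k i * P + (y k i.+1 - c k q * y k i) * s k i P).

Definition mTinv k i (G : V k) : V k :=
  epsilon (inhabits 0) (fun F => mT i F = G).

Lemma ddiffE k i (F : V k) : (0 < i < k)%N ->
  ddiff i F * (y k i.+1 - y k i) = s k i F - F.
Proof. by move=> ik; exact: (epsilon_spec _ _ (y_sub_s_dvd F ik)). Qed.

Let d_reg k i : (0 < i < k)%N -> GRing.rreg (y k i.+1 - y k i).
Proof. by move=> ik; apply: my_rreg; lia. Qed.

Lemma mT_mulE k i (F : V k) : (0 < i < k)%N ->
  mT i F * (y k i.+1 - y k i) =
  c k (q - 1) * y k i * F + (y k i.+1 - c k q * y k i) * s k i F.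
Proof.
move=> ik; apply: (epsilon_spec (inhabits (0 : V k)) (fun C => C * _ = _)).
exists (F + (y k i.+1 - c k q * y k i) * ddiff i F).
by rewrite mulrDl -mulrA ddiffE // rmorphB rmorph1; ring.
Qed.

Lemma mT_uniq k i (F C : V k) : (0 < i < k)%N ->
  C * (y k i.+1 - y k i) =
  c k (q - 1) * y k i * F + (y k i.+1 - c k q * y k i) * s k i F ->
  mT i F = C.
Proof. by move=> ik eC; apply: (d_reg ik); rewrite mT_mulE. Qed.

Lemma mTE k i (F : V k) : (0 < i < k)%N ->
  mT i F = F + (y k i.+1 - c k q * y k i) * ddiff i F.
Proof.
move=> ik; apply: mT_uniq => //.
by rewrite mulrDl -mulrA ddiffE // rmorphB rmorph1; ring.
Qed.

Lemma ms_ddiff k i (F : V k) : (0 < i < k)%N -> s k i (ddiff i F) = ddiff i F.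
Proof.
move=> ik; apply: (d_reg ik); rewrite ddiffE //.
have := congr1 (s k i) (ddiffE F ik).
rewrite rmorphM !rmorphB msK // ms_yl // ms_yr // => e.
by rewrite -[LHS]opprK -mulrN opprB e opprB.
Qed.

Lemma mT_linear k i (a : K) (F G : V k) : (0 < i < k)%N ->
  mT i (c k a * F + G) = c k a * mT i F + mT i G.
Proof.
move=> ik; apply: mT_uniq => //.
rewrite mulrDl -mulrA !mT_mulE // (rmorphD (s k i)) (rmorphM (s k i)) ms_c; ring.
Qed.

Lemma mTD k i (F G : V k) : (0 < i < k)%N -> mT i (F + G) = mT i F + mT i G.
Proof. by move=> ik; have := mT_linear 1 F G ik; rewrite rmorph1 !mul1r. Qed.

Lemma mT_id k i (F : V k) : (0 < i < k)%N -> s k i F = F -> mT i F = F.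
Proof. by move=> ik e; apply: mT_uniq; rewrite // e rmorphB rmorph1; ring. Qed.

Lemma mTMl k i (F G : V k) : (0 < i < k)%N -> s k i G = G ->
  mT i (G * F) = G * mT i F.
Proof.
by move=> ik e; apply: mT_uniq; rewrite // -mulrA mT_mulE // rmorphM e; ring.
Qed.

Lemma mT_yS k i : (0 < i < k)%N -> mT i (y k i.+1) = c k q * y k i.
Proof.
by move=> ik; apply: mT_uniq; rewrite // ms_yr // rmorphB rmorph1; ring.
Qed.

(** T_i is built from s_i and multiplication by y_i and y_{i+1}. As [f] need only be linear, this
    applies to d_- and to another T_j too. *)
Lemma mT_intertwine k m i j (f : V k -> V m) (F : V k) :
  (0 < i < k)%N -> (0 < j < m)%N ->
  (forall a F G, f (c k a * F + G) = c m a * f F + f G) ->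
  (forall F, f (y k i * F) = y m j * f F) ->
  (forall F, f (y k i.+1 * F) = y m j.+1 * f F) ->
  (forall F, f (s k i F) = s m j (f F)) ->
  f (mT i F) = mT j (f F).
Proof.
move=> ik jm flin fy fy' fs; apply/esym/mT_uniq => //.
have fZ a G : f (c k a * G) = c m a * f G.
  have f0 : f 0 = 0.
    have := flin 1 0 0; rewrite !rmorph1 !mul1r addr0 => /eqP.
    by rewrite -subr_eq0 opprD addNKr oppr_eq0 => /eqP.
  by rewrite -[_ * G]addr0 flin f0 addr0.
have fD G H : f (G + H) = f G + f H.
  by have := flin 1 G H; rewrite !rmorph1 !mul1r.
have fB G H : f (G - H) = f G - f H.
  by rewrite fD -[- H]mulN1r -(rmorphN1 (c k)) fZ rmorphN1 mulN1r.
rewrite mulrBr ![f _ * _]mulrC -fy' -fy -fB -mulrBl mulrC mT_mulE //.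
by rewrite fD mulrBl fB fy' -!mulrA !fZ !fy fs; ring.
Qed.

Lemma mT_quad k i (F : V k) : (0 < i < k)%N ->
  mT i (mT i F) = c k (1 - q) * mT i F + c k q * F.
Proof.
move=> ik; rewrite !(mTE _ ik); set D := ddiff i F.
set u := y k i.+1 - _.
(* [D] is symmetric in y_i, y_{i+1}, and the divided difference of y_{i+1} - q y_i is -(1 + q);
   together D - (1 + q) D. *)
have -> : ddiff i (F + u * D) = - c k q * D.
  apply: (d_reg ik).
  rewrite ddiffE // rmorphD rmorphM rmorphB rmorphM ms_c ms_ddiff //.
  have eF : s k i F = F + D * (y k i.+1 - y k i) by rewrite ddiffE //; ring.
  by rewrite eF ms_yl // ms_yr // -/D /u; ring.
by rewrite rmorphB rmorph1; ring.
Qed.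

Lemma ms_comm k i j (F : V k) : (0 < i < k)%N -> (0 < j < k)%N ->
  (i.+1 < j)%N || (j.+1 < i)%N -> s k i (s k j F) = s k j (s k i F).
Proof.
move=> ik jk ij.
apply: (@rmorph_model_eq k _ (s k i \o s k j) (s k j \o s k i)) => /=.
- by move=> a; rewrite !ms_c.
- by move=> n n0; rewrite !ms_p.
- move=> l lk; rewrite !ms_y ?swap_index_bound //; congr my.
  by rewrite /swap_index; do !case: eqP; lia.
Qed.

Lemma mT_comm k i j (F : V k) : (0 < i < k)%N -> (0 < j < k)%N ->
  (i.+1 < j)%N || (j.+1 < i)%N -> mT i (mT j F) = mT j (mT i F).
Proof.
move=> ik jk ij; apply/esym/mT_intertwine => // [a G H|G|G|G].
- exact: mT_linear.
- by rewrite mTMl // ms_y_id //; lia.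
- by rewrite mTMl // ms_y_id //; lia.
- apply: mT_uniq => //.
  have := congr1 (s k i) (mT_mulE G jk).
  rewrite !(rmorphM, rmorphB, rmorphD) !rmorph1 !ms_c ms_comm //.
  by rewrite !ms_y_id //; lia.
Qed.

Lemma mT_braid k i (F : V k) : (0 < i)%N -> (i.+1 < k)%N ->
  mT i (mT i.+1 (mT i F)) = mT i.+1 (mT i (mT i.+1 F)).
Proof.
move=> i0 ik.
apply: (@Hecke_braid (V k) (c k q) (y k i) (y k i.+1) (y k i.+2) (s k i) (s k i.+1)).
1,5: exact: ms_c.
1-6: by rewrite ms_y; [congr my; rewrite /swap_index; do !case: eqP; lia | lia].
1,2: by move=> G; rewrite msK //; lia.
2,3: by move=> G; rewrite mT_mulE ?rmorphB ?rmorph1 //; lia.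
2-4: by apply: my_rreg; lia.
apply: (@rmorph_model_eq k _ (s k i \o (s k i.+1 \o s k i))
   (s k i.+1 \o (s k i \o s k i.+1))) => /=.
- by move=> a; rewrite !ms_c.
- by move=> n n0; rewrite !ms_p.
- move=> l lk; rewrite !ms_y ?swap_index_bound; try lia; congr my.
  by rewrite /swap_index; do !case: eqP; lia.
Qed.

Hypothesis q0 : q != 0.

(** The quadratic relation T^2 = (1 - q) T + q, solved for T^{-1}. *)
Lemma mT_right_inv k i (F : V k) : (0 < i < k)%N ->
  mT i (c k q^-1 * mT i F + c k (1 - q^-1) * F) = F.
Proof.
move=> ik; have qV : c k q^-1 * c k q = 1 by rewrite -rmorphM mulVf // rmorph1.
rewrite mT_linear // mT_quad // mTMl ?ms_c // !rmorphB rmorph1.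
have -> : forall a b : V k, c k q^-1 * ((1 - c k q) * a + c k q * b)
    + (1 - c k q^-1) * a = (1 - c k q^-1 * c k q) * a + (c k q^-1 * c k q) * b.
  by move=> a b; ring.
by rewrite qV; ring.
Qed.

Lemma mT_inj k i : (0 < i < k)%N -> injective (@mT k i).
Proof.
move=> ik F G eFG; have qV : c k q^-1 * c k q = 1 by rewrite -rmorphM mulVf // rmorph1.
have e H : H = c k q^-1 * (mT i (mT i H) - c k (1 - q) * mT i H).
  rewrite mT_quad // -[LHS]mul1r -qV; ring.
by rewrite (e F) eFG -e.
Qed.

Lemma mTinvK k i : (0 < i < k)%N -> cancel (@mTinv k i) (@mT k i).
Proof.
move=> ik F; apply: (epsilon_spec (inhabits (0 : V k)) (fun G => mT i G = _)).
by eexists; exact: mT_right_inv.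
Qed.

Lemma mTK k i : (0 < i < k)%N -> cancel (@mT k i) (@mTinv k i).
Proof. by move=> ik F; apply: (mT_inj ik); rewrite mTinvK. Qed.

Lemma mTinvE k i (F : V k) : (0 < i < k)%N ->
  mTinv i F = c k q^-1 * mT i F + c k (1 - q^-1) * F.
Proof. by move=> ik; apply: (mT_inj ik); rewrite mTinvK // mT_right_inv. Qed.

End Hecke.

Lemma natr_lreg (K : fieldType) (R : comNzRingType) (f : {rmorphism K -> R}) n :
  n.+1%:R != 0 :> K -> GRing.lreg (n.+1%:R : R).
Proof.
move=> n0 a b /= e; have e1 : f n.+1%:R^-1 * n.+1%:R = 1.
  by rewrite -(rmorph_nat f) -rmorphM mulVf // rmorph1.
by rewrite -[a]mul1r -[b]mul1r -e1 -!mulrA e.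
Qed.

Lemma swapXYM (R : comNzRingType) : {morph @swapXY R : u v / u * v}.
Proof. exact: rmorphM. Qed.

Lemma swapXYB (R : comNzRingType) : {morph @swapXY R : u v / u - v}.
Proof. exact: rmorphB. Qed.

Lemma swapXY_affine (R : comNzRingType) (A : {poly R}) (a : R) n :
  swapXY (A%:P - a%:P%:P * 'X^n) = map_poly polyC A - a%:P%:P * 'X%:P ^+ n.
Proof.
by rewrite swapXYB swapXY_polyC swapXYM swapXY_polyC map_polyC rmorphXn /= swapXY_X.
Qed.

(** * How the homomorphisms act on kernels and commute with each other *)

Section Intertwining.
Variables (K : fieldType) (q t : K) (M : model q t).
Hypothesis charK : forall n, n.+1%:R != 0 :> K.
Local Notation V := (mV M).
Local Notation c := (mc M).
Local Notation p := (mp M).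
Local Notation y := (my M).
Local Notation s := (ms M).
Local Notation D := (@mD _ _ _ M _).
Local Notation d := (@mdp _ _ _ M _).
Local Notation S := (@mS _ _ _ M _).
Local Notation H := (mH M).
Local Notation dm := (@mdm _ _ _ M _).
Local Notation T := (@mT _ _ _ M _).

Lemma newton_H k : newton (p k) (H k).
Proof. by split=> [|n]; [exact: mH_0 | rewrite -(rmorph_nat (c k)) mH_S]. Qed.

(** If f(p_n) = p'_n + b^n - a^n, then f multiplies the exponential series by (1 - b z)/(1 - a z);
    here with the denominator cleared. *)
Lemma rmorph_H_eq k (R : comNzRingType) (f : {rmorphism V k -> R})
    (h : nat -> R) (a b : R) p' : newton p' h ->
  (forall n, (0 < n)%N -> f (p k n) + a ^+ n = p' n + b ^+ n) ->
  seq_mul a (f \o H k) =1 seq_mul b h.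
Proof.
move=> hN e; have reg n : GRing.lreg (n.+1%:R : R).
  exact: (@natr_lreg K R (f \o c k)).
apply: (newton_uniq reg _ (newton_seq_mul a (rmorph_newton f (newton_H k)))
  (newton_seq_mul b hN)); exact: e.
Qed.

Lemma ms_H k i n : s k i (H k n) = H k n.
Proof.
(* The trivial factor 1 - 0 z only produces the shape of [rmorph_H_eq]. *)
apply: (@seq_mul_inj _ 0 (s k i \o H k)).
by apply: (rmorph_H_eq (newton_H k)) => m m0; rewrite ms_p.
Qed.

Lemma mD_H k : seq_mul (y k.+1 k.+1) (D \o H k)
  =1 seq_mul (c k.+1 q * y k.+1 k.+1) (H k.+1).
Proof.
apply: (rmorph_H_eq (newton_H _)) => n n0.
by rewrite mD_p // rmorphB rmorph1 rmorphXn exprMn; ring.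
Qed.

Definition ty1 k : V k.+1 := c k.+1 t * y k.+1 1.

Lemma mdp_H k : seq_mul (ty1 k) (d \o H k) =1 seq_mul (c k.+1 q * ty1 k) (H k.+1).
Proof.
apply: (rmorph_H_eq (newton_H _)) => n n0.
by rewrite mdp_p // rmorphB rmorph1 rmorphXn /ty1 !exprMn; ring.
Qed.

(** The interaction of two successive residues: with z = 1/u and inner variable v, the kernel
    acquires the factor (u - v)/(u - q v). *)
Lemma mS_H k :
  seq_mul ((c k q)%:P * 'X) (S \o H k.+1) =1 seq_mul 'X (polyC \o H k).
Proof.
apply: (rmorph_H_eq (rmorph_newton (polyC : {rmorphism V k -> {poly V k}}) (newton_H k))).
by move=> n n0; rewrite mS_p // exprMn rmorphB rmorph1 !rmorphXn /= polyCB polyC1 rmorphXn; ring.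
Qed.

Lemma mDs k i (F : V k) : (0 < i < k)%N -> D (s k i F) = s k.+1 i (D F).
Proof.
move=> ik; apply: (@rmorph_model_eq _ _ _ M k _ (D \o s k i) (s k.+1 i \o D)) F => /=.
- by move=> a; rewrite ms_c mD_c ms_c.
- move=> n n0; rewrite ms_p // mD_p // (rmorphD (s k.+1 i)) (rmorphM (s k.+1 i)).
  rewrite (rmorphXn (s k.+1 i)) ms_p // ms_c.
  by rewrite ms_y_id //; lia.
- move=> j jk; have jk' := swap_index_bound ik jk.
  by rewrite ms_y // !mD_y // ms_y //; lia.
Qed.

Lemma mdps k i (F : V k) : (0 < i < k)%N -> d (s k i F) = s k.+1 i.+1 (d F).
Proof.
move=> ik; apply: (@rmorph_model_eq _ _ _ M k _ (d \o s k i) (s k.+1 i.+1 \o d)) F => /=.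
- by move=> a; rewrite ms_c mdp_c ms_c.
- move=> n n0; rewrite ms_p // mdp_p // (rmorphD (s k.+1 i.+1)) (rmorphM (s k.+1 i.+1)).
  rewrite (rmorphXn (s k.+1 i.+1)) (rmorphM (s k.+1 i.+1)).
  by rewrite ms_p // !ms_c ms_y_id //; lia.
- move=> j jk; have jk' := swap_index_bound ik jk.
  rewrite ms_y // !mdp_y // ms_y; last lia.
  by congr my; rewrite /swap_index; do !case: eqP; lia.
Qed.

Lemma map_s_S k i (F : V k.+1) : (0 < i < k)%N ->
  map_poly (s k i) (S F) = S (s k.+1 i F).
Proof.
move=> ik; apply: (@rmorph_model_eq _ _ _ M k.+1 _
  (map_poly (s k i) \o S) (S \o s k.+1 i)) F => /=.
- by move=> a; rewrite ms_c mS_c map_polyC /= ms_c.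
- move=> n n0; rewrite ms_p // mS_p // (rmorphB (map_poly _)) (rmorphM (map_poly _)) /=.
  rewrite !map_polyC map_polyXn /=.
  by rewrite ms_p // ms_c.
- move=> j jk; rewrite ms_y //; have [->|jk'] := eqVneq j k.+1.
    by rewrite swap_index_id ?mS_last ?map_polyX //; lia.
  have jk2 : (0 < j <= k)%N by lia.
  have jk3 := swap_index_bound ik jk2.
  by rewrite !mS_y // map_polyC /= ms_y.
Qed.

Lemma map_d_S k (F : V k.+1) : map_poly d (S F) = S (d F).
Proof.
apply: (@rmorph_model_eq _ _ _ M k.+1 _ (map_poly d \o S) (S \o d)) F => /=.
- by move=> a; rewrite mS_c map_polyC /= !mdp_c mS_c.
- move=> n n0; rewrite mS_p // (rmorphB (map_poly _)) (rmorphM (map_poly _)) /=.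
  rewrite !map_polyC map_polyXn /=.
  rewrite !mdp_p // !mdp_c (rmorphD S) (rmorphM S) (rmorphXn S) (rmorphM S).
  rewrite mS_p // !mS_c mS_y //.
  by rewrite -polyCM -polyC_exp -polyCM polyCD; ring.
- move=> j jk; have [->|jk'] := eqVneq j k.+1.
    by rewrite mS_last map_polyX mdp_y ?leqnn // mS_last.
  have jk2 : (0 < j <= k)%N by lia.
  by rewrite mS_y // map_polyC /= !mdp_y // mS_y //; lia.
Qed.

Lemma mD_linear k a (F G : V k) : D (c k a * F + G) = c k.+1 a * D F + D G.
Proof. by rewrite rmorphD rmorphM mD_c. Qed.

Lemma mdp_linear k a (F G : V k) : d (c k a * F + G) = c k.+1 a * d F + d G.
Proof. by rewrite rmorphD rmorphM mdp_c. Qed.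

Lemma mdm_linear k a (F G : V k.+1) : dm (c k.+1 a * F + G) = c k a * dm F + dm G.
Proof.
rewrite !mdmE rmorphD rmorphM mS_c mulrDr mulrCA pairingD pairing_CM.
by rewrite opprD mulrN.
Qed.

Lemma mdm_yM k i (F : V k.+1) : (0 < i <= k)%N ->
  dm (y k.+1 i * F) = y k i * dm F.
Proof.
by move=> ik; rewrite !mdmE rmorphM mS_y // mulrCA pairing_CM mulrN.
Qed.

Lemma mdms k i (F : V k.+1) : (0 < i < k)%N -> dm (s k.+1 i F) = s k i (dm F).
Proof.
move=> ik; rewrite !mdmE rmorphN rmorph_pairing rmorphM /= map_polyX map_s_S //.
by congr (- _); apply: eq_pairing => n; rewrite /= ms_H.
Qed.

Lemma mD_T k i (F : V k) : (0 < i < k)%N -> D (T i F) = T i (D F).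
Proof.
move=> ik; apply: mT_intertwine => // [|a G G'|G|G|G].
- lia.
- exact: mD_linear.
- by rewrite rmorphM mD_y //; lia.
- by rewrite rmorphM mD_y //; lia.
- exact: mDs.
Qed.

Lemma mdp_T k i (F : V k) : (0 < i < k)%N -> d (T i F) = T i.+1 (d F).
Proof.
move=> ik; apply: mT_intertwine => // [|a G G'|G|G|G].
- lia.
- exact: mdp_linear.
- by rewrite rmorphM mdp_y //; lia.
- by rewrite rmorphM mdp_y //; lia.
- exact: mdps.
Qed.

Lemma mdm_T k i (F : V k.+1) : (0 < i < k)%N -> dm (T i F) = T i (dm F).
Proof.
move=> ik; apply: mT_intertwine => // [|a G G'|G|G|G].
- lia.
- exact: mdm_linear.
- by rewrite mdm_yM //; lia.
- by rewrite mdm_yM //; lia.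
- exact: mdms.
Qed.

(** The two shifts of X are by (q-1) t y_1 and (q-1) t y_2, and every y_j becomes y_{j+2}. *)
Lemma ms1_d2 k (F : V k) : s k.+2 1 (d (d F)) = d (d F).
Proof.
apply: (@rmorph_model_eq _ _ _ M k _ (s k.+2 1 \o (d \o d)) (d \o d)) F => /=.
- by move=> a; rewrite !mdp_c ms_c.
- move=> n n0; rewrite !(mdp_p, rmorphD, rmorphM, rmorphXn) // !mdp_c !mdp_y //.
  by rewrite !ms_p // !ms_c ms_yl // ms_yr //; ring.
- by move=> j jk; rewrite !mdp_y ?ms_y_id //; lia.
Qed.

Lemma mT1_d2 k (F : V k) : T 1 (d (d F)) = d (d F).
Proof. by rewrite mT_id // ms1_d2. Qed.

Definition mC k (F : V k.+1) : V k.+1 := d (dm F) - dm (d F).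

(* [h_n[-X + t y_1]] *)
Definition mJ k : nat -> V k.+1 := seq_div (ty1 k) (H k.+1).

Lemma mJK k : seq_mul (ty1 k) (mJ k) =1 H k.+1.
Proof. exact: seq_divK. Qed.

Lemma mdp_H_J k : d \o H k =1 seq_mul (c k.+1 q * ty1 k) (mJ k).
Proof.
apply: (@seq_mul_inj _ (ty1 k)) => n; rewrite mdp_H seq_mulC.
by apply: eq_seq_mul => {}n; rewrite mJK.
Qed.

(** Both terms pair the same polynomial with [mJ], with factors u - a and u - q a for a = t y_1;
    their difference is the constant (q-1) a. *)
Lemma mC_E k (F : V k.+1) :
  mC F = c k.+1 (q - 1) * ty1 k * pairing (mJ k) (S (d F)).
Proof.
rewrite /mC !mdmE rmorphN rmorph_pairing rmorphM /= map_polyX map_d_S.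
rewrite (eq_pairing (@mdp_H_J k)) -(eq_pairing (@mJK k)) !pairing_seq_mul_X.
rewrite opprK addrC -pairingB -mulrBl.
have -> : 'X - (ty1 k)%:P - ('X - (c k.+1 q * ty1 k)%:P)
  = (c k.+1 (q - 1) * ty1 k)%:P.
  by rewrite (rmorphB (c k.+1)) rmorph1 !polyCM polyCB polyC1; ring.
by rewrite pairing_CM.
Qed.

(** With X0, X1 symmetric in y_1, y_2, the two sides come from b (X0 - q a X1) and a (X0 - b X1).
    T_1 sends b to q a and fixes the symmetric a b. *)
Lemma mT1_d_C k (F : V k.+1) : T 1 (d (mC F)) = c k.+2 q * mC (d F).
Proof.
pose a := ty1 k.+1; pose b := c k.+2 t * y k.+2 2.
have da : d (ty1 k) = b by rewrite rmorphM mdp_c mdp_y.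
have sa : s k.+2 1 a = b by rewrite rmorphM ms_c ms_yl.
have sb : s k.+2 1 b = a by rewrite rmorphM ms_c ms_yr.
pose Q := seq_div b (mJ k.+1).
have QK : seq_mul b Q =1 mJ k.+1 by exact: seq_divK.
have dJ : d \o mJ k =1 seq_mul (c k.+2 q * a) Q.
  apply: (@seq_mul_inj _ b) => n; rewrite -da -rmorph_seq_mul /= mJK -/(( d \o H k.+1) n).
  rewrite da seq_mulC mdp_H_J; apply: eq_seq_mul => {}n; by rewrite QK.
(* (1 - a z)(1 - b z) Q is the invariant series [H], and s_1 exchanges a and b. *)
have sQ : s k.+2 1 \o Q =1 Q.
  apply: (@seq_mul_inj _ a); apply: (@seq_mul_inj _ b) => n.
  transitivity (H k.+2 n); last first.
    by rewrite seq_mulC -mJK; apply: eq_seq_mul => {}n; rewrite QK.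
  rewrite -[RHS](ms_H k.+2 1) -mJK -/a -[RHS]/((s k.+2 1 \o seq_mul _ _) n).
  rewrite rmorph_seq_mul sa; apply: eq_seq_mul => {}n.
  by rewrite -sb -rmorph_seq_mul /= QK.
rewrite !mC_E (rmorphM d (_ * _)) (rmorphM d (c _ _)) mdp_c da rmorph_pairing map_d_S (eq_pairing dJ).
set P := S (d (d F)).
have sP : map_poly (s k.+2 1) P = P by rewrite /P map_s_S // ms1_d2.
rewrite -(eq_pairing QK) !pairing_seq_mul.
have sX0 : s k.+2 1 (pairing Q P) = pairing Q P.
  by rewrite rmorph_pairing sP (eq_pairing sQ).
have sX1 : s k.+2 1 (pairing (seq_shift Q) P) = pairing (seq_shift Q) P.
  rewrite rmorph_pairing sP; apply: eq_pairing => n.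
  by rewrite rmorph_seq_shift (eq_seq_shift sQ).
move: (pairing Q P) (pairing (seq_shift Q) P) sX0 sX1 => X0 X1 sX0 sX1.
have -> : c k.+2 (q - 1) * b * (X0 - c k.+2 q * a * X1) =
   (c k.+2 (q - 1) * c k.+2 t * X0) * y k.+2 2
   + - c k.+2 (q - 1) * c k.+2 q * (a * b * X1) by rewrite /b; ring.
have -> : T 1 ((c k.+2 (q - 1) * c k.+2 t * X0) * y k.+2 2
   + - c k.+2 (q - 1) * c k.+2 q * (a * b * X1))
   = (c k.+2 (q - 1) * c k.+2 t * X0) * (c k.+2 q * y k.+2 1)
     + - c k.+2 (q - 1) * c k.+2 q * (a * b * X1).
  rewrite mTD // mTMl //; last by rewrite !rmorphM !ms_c sX0.
  rewrite mT_yS // mT_id // (rmorphM _ _ (_ * X1)) (rmorphM _ _ X1) sX1.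
  by rewrite (rmorphM _ a) sa sb rmorphM rmorphN !ms_c; ring.
by rewrite /a /ty1; ring.
Qed.

Lemma map_S_S_swap k (F : V k.+2) :
  map_poly S (S (s k.+2 k.+1 F)) = swapXY (map_poly S (S F)).
Proof.
apply: (@rmorph_model_eq _ _ _ M k.+2 _ (map_poly S \o (S \o s k.+2 k.+1))
   (swapXY \o (map_poly S \o S))) F => /=.
- by move=> a; rewrite ms_c !mS_c !map_polyC /= mS_c swapXY_polyC map_polyC.
- move=> n n0; rewrite ms_p // mS_p // (rmorphB (map_poly S)) (rmorphM (map_poly S)) /=.
  rewrite !map_polyC map_polyXn /= mS_p // mS_c.
  rewrite swapXY_affine (rmorphB (map_poly polyC)) (rmorphM (map_poly polyC)) /=.
  by rewrite !map_polyC map_polyXn /= polyCB polyCM polyC_exp; ring.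
- have k1 : (0 < k.+1 < k.+2)%N by lia.
  have k2 : (0 < k.+1 <= k.+1)%N by lia.
  move=> j jk; have [->|jk1] := eqVneq j k.+2.
    by rewrite ms_yr // mS_y // mS_last map_polyC map_polyX /= mS_last swapXY_X.
  have [->|jk2] := eqVneq j k.+1.
    by rewrite ms_yl // mS_last mS_y // map_polyC map_polyX /= mS_last swapXY_Y.
  rewrite ms_y_id // mS_y; last lia.
  by rewrite map_polyC /= mS_y ?swapXY_polyC ?map_polyC //; lia.
Qed.

End Intertwining.

(** * Relations for d_-^2 and for the commutator of d_+^* and d_- *)

Section CommutatorRelations.
Variables (K : fieldType) (q t : K) (M : model q t).
Hypothesis charK : forall n, n.+1%:R != 0 :> K.
Hypothesis q0 : q != 0.
Local Notation V := (mV M).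
Local Notation c := (mc M).
Local Notation y := (my M).
Local Notation s := (ms M).
Local Notation D := (@mD _ _ _ M _).
Local Notation d := (@mdp _ _ _ M _).
Local Notation S := (@mS _ _ _ M _).
Local Notation H := (mH M).
Local Notation dm := (@mdm _ _ _ M _).
Local Notation T := (@mT _ _ _ M _).
Local Notation Tinv := (@mTinv _ _ _ M _).
Local Notation C := (@mC _ _ _ M _).
Local Notation J := (mJ M).
Local Notation ty1 := (ty1 M).

(* The outer variable ['X] is the image of y_{k+2}, the inner one ['X%:P] that of
   y_{k+1}. *)
Definition mSS k (F : V k.+2) : {poly {poly V k}} := map_poly S (S F).

(** [W] is the image of the divided difference; it stands for the quotient by u - v in the
    polynomial ring. *)
Lemma mSS_T k (F : V k.+2) : exists W : {poly {poly V k}},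
  [/\ mSS (T k.+1 F) = mSS F + ('X - ((c k q)%:P * 'X)%:P) * W,
      ('X - 'X%:P) * W = swapXY (mSS F) - mSS F & swapXY W = W].
Proof.
have k1 : (0 < k.+1 < k.+2)%N by lia.
have k2 : (0 < k.+1 <= k.+1)%N by lia.
have eX : mSS (y k.+2 k.+2) = 'X by rewrite /mSS mS_last map_polyX.
have eY : mSS (y k.+2 k.+1) = 'X%:P.
  by rewrite /mSS mS_y // map_polyC /= mS_last.
have mSSM F' G : mSS (F' * G) = mSS F' * mSS G by rewrite /mSS !rmorphM.
have mSSB F' G : mSS (F' - G) = mSS F' - mSS G by rewrite /mSS !rmorphB.
have mSSD F' G : mSS (F' + G) = mSS F' + mSS G by rewrite /mSS !rmorphD.
have mSSc : mSS (c k.+2 q) = (c k q)%:P%:P by rewrite /mSS mS_c map_polyC /= mS_c.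
exists (mSS (ddiff k.+1 F)); split.
- by rewrite mTE // mSSD mSSM mSSB mSSM eX eY mSSc polyCM.
- rewrite -eX -eY -mSSB mulrC -mSSM ddiffE // mSSB; congr (_ - _).
  exact: map_S_S_swap.
- by rewrite /mSS -map_S_S_swap ms_ddiff.
Qed.

Lemma mdm2_T k (F : V k.+2) : dm (dm (T k.+1 F)) = dm (dm F).
Proof.
have dm2 G : dm (dm G) = pairing (H k) ('X * pairing (S \o H k.+1) ('X * mSS G)).
  rewrite !mdmE rmorphN rmorph_pairing rmorphM /= map_polyX.
  by rewrite mulrN pairingN opprK.
have [W [eT eW sW]] := mSS_T F.
rewrite !dm2 eT; apply/eqP; rewrite -subr_eq0 -pairingB -mulrBr -pairingB -mulrBr.
(* The factor u - q v contributed by T is exchanged for u - v by the interaction of the residues,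
   and (u - v) W is a difference of swapped terms. *)
rewrite [_ + _ * W]addrC addrK mulrCA -pairing_seq_mul_X (eq_pairing (@mS_H _ _ _ M charK k)).
rewrite pairing_seq_mul_X -pairing_CM.
have -> : 'X%:P * (('X - 'X%:P) * ('X * W))
    = swapXY ('X * 'X%:P * mSS F) - 'X * 'X%:P * mSS F.
  rewrite !swapXYM swapXY_X swapXY_Y [_ * ('X * W)]mulrCA eW; ring.
by rewrite !pairingB pairing2_swapXY subrr.
Qed.

Lemma mdm_C_T k (F : V k.+2) : c k.+1 q * dm (C F) = C (dm (T k.+1 F)).
Proof.
have k1 : (0 < k.+1 < k.+2)%N by lia.
pose a := ty1 k; pose I := S \o J k.+1.
have Sa : S (ty1 k.+1) = a%:P by rewrite rmorphM mS_c mS_y // polyCM.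
(* The kernel [J] interacts with the inner variable exactly as [H] does, since 1 - a z is constant
   in it. *)
have eI : seq_mul ((c k.+1 q)%:P * 'X) I =1 seq_mul 'X (polyC \o J k).
  apply: (@seq_mul_inj _ a%:P) => n; rewrite seq_mulC [RHS]seq_mulC.
  transitivity (seq_mul ((c k.+1 q)%:P * 'X) (S \o H k.+2) n).
    apply: eq_seq_mul => {}n; rewrite -Sa -rmorph_seq_mul /=.
    by rewrite mJK.
  rewrite mS_H //; apply: eq_seq_mul => {}n; rewrite -rmorph_seq_mul /=.
  by rewrite mJK.
have eSdH : S \o (d \o H k.+1) =1 seq_mul ((c k.+1 q)%:P * a%:P) I.
  by move=> n; rewrite /= -/((d \o H k.+1) n) mdp_H_J // -/((S \o seq_mul _ _) n)
    rmorph_seq_mul rmorphM mS_c Sa.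
have [W [eP1 eW sW]] := mSS_T (d F).
set P := mSS (d F) in eP1 eW.
have eL : dm (C F) = - (c k.+1 (q - 1) * a
    * pairing (J k) (pairing I (('X%:P - a%:P%:P) * P))).
  rewrite mC_E // mdmE 2!rmorphM mS_c Sa rmorph_pairing -/(mSS _) -/P -/I -polyCM.
  rewrite mulrCA pairing_CM -(eq_pairing (@mJK _ _ _ M k)) pairing_seq_mul_X.
  by rewrite -polyCB pairing_CM.
have eR : C (dm (T k.+1 F)) = - (c k.+1 (q - 1) * a
    * pairing (J k) (pairing I (('X - ((c k.+1 q)%:P * a%:P)%:P) * mSS (d (T k.+1 F))))).
  rewrite mC_E // mdmE (rmorphN d) (rmorphN S) (rmorph_pairing d).
  rewrite (rmorphM (map_poly d)) /= map_polyX map_d_S rmorph_pairing.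
  rewrite (rmorphM (map_poly S)) /= map_polyX -/(mSS _) (eq_pairing eSdH).
  by rewrite pairing_seq_mul_X pairingN mulrN.
rewrite eR eL mdp_T // eP1 mulrN; congr (- _).
rewrite mulrCA; congr (_ * _); apply/eqP.
rewrite -pairing_CM -pairing_CM -subr_eq0 -pairingB -pairingB.
set v : {poly {poly V k.+1}} := 'X%:P; set u : {poly {poly V k.+1}} := 'X.
pose Q : {poly {poly V k.+1}} := (c k.+1 q)%:P%:P.
pose A : {poly {poly V k.+1}} := a%:P%:P.
(* The difference of the two integrands is divisible by u - q v, which the kernel again exchanges
   for u - v, leaving G - [swapXY] G with G = (u - q a) [swapXY] P. *)
have -> : Q * ((v - A) * P) - (u - ((c k.+1 q)%:P * a%:P)%:P)
     * (P + (u - ((c k.+1 q)%:P * 'X)%:P) * W)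
   = - ((u - ((c k.+1 q)%:P * 'X)%:P) * (P + (u - Q * A) * W)).
  by rewrite (polyCM _ 'X) (polyCM _ a%:P) -/Q -/A -/v; ring.
rewrite !pairingN oppr_eq0 -pairing_seq_mul_X (eq_pairing eI) pairing_seq_mul_X.
have -> : ('X - 'X%:P) * (P + (u - Q * A) * W)
    = (u - Q * A) * swapXY P - swapXY ((u - Q * A) * swapXY P).
  rewrite swapXYM swapXYK swapXYB swapXY_X swapXYM !swapXY_polyC !map_polyC.
  by rewrite mulrDr mulrCA eW -/u -/v /= -/Q -/A; ring.
by rewrite !pairingB pairing2_swapXY subrr.
Qed.

(** X gains (q-1) times the last y, that y becomes u, and X loses (q-1) u: the shifts cancel and no
    u remains. *)
Lemma mS_d_D k (F : V k) : S (d (D F)) = (d F)%:P.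
Proof.
apply: (@rmorph_model_eq _ _ _ M k _ (S \o (d \o D)) (polyC \o d)) F => /=.
- by move=> a; rewrite mD_c !mdp_c mS_c.
- move=> n n0; have k1 : (0 < k.+1 <= k.+1)%N by lia.
  rewrite mD_p // (rmorphD d) (rmorphM d) (rmorphXn d) mdp_c mdp_y // mdp_p // mdp_p //.
  rewrite !(rmorphD S) !(rmorphM S) !(rmorphXn S) (rmorphM S) !mS_c mS_last mS_p //.
  by rewrite mS_y // -polyCM -polyC_exp -polyCM polyCD; ring.
- by move=> j jk; rewrite mD_y // !mdp_y ?mS_y //; lia.
Qed.

Lemma mC_D k (F : V k) : C (D F) = c k.+1 (q - 1) * ty1 k * d F.
Proof. by rewrite mC_E // mS_d_D pairing_C /mJ /= mH_0 mulr1. Qed.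

(** Under S and d the defining equation of T_{k+1} acquires the divisor u - v. Its unswapped term is
    constant in u and dies in the residue; the swapped one carries u - q v, the factor that D puts
    on the kernel. *)
Lemma mC_T_D k (F : V k.+1) : C (T k.+1 (D F)) = D (C F).
Proof.
have k1 : (0 < k.+1 < k.+2)%N by lia.
have k2 : (0 < k.+1 <= k.+1)%N by lia.
have k3 : (0 < k.+2 <= k.+2)%N by lia.
pose v := y k.+2 k.+2; pose N := seq_div v (J k.+1).
have NK : seq_mul v N =1 J k.+1 by exact: seq_divK.
have Da : D (ty1 k) = ty1 k.+1 by rewrite rmorphM mD_c mD_y.
have DJ : D \o J k =1 seq_mul (c k.+2 q * v) N.
  apply: (@seq_mul_inj _ v); apply: (@seq_mul_inj _ (ty1 k.+1)) => n.
  rewrite seq_mulC.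
  transitivity (seq_mul v (D \o H k.+1) n).
    apply: eq_seq_mul => {}n; rewrite -Da -rmorph_seq_mul /=.
    by rewrite mJK.
  rewrite mD_H // -/v.
  transitivity (seq_mul (c k.+2 q * v) (seq_mul (ty1 k.+1) (J k.+1)) n).
    by apply: eq_seq_mul => {}n; rewrite mJK.
  rewrite seq_mulC; apply: eq_seq_mul => {}n; rewrite seq_mulC.
  by apply: eq_seq_mul => {}n; rewrite NK.
have eDS : map_poly D (S (d F)) = S (d (s k.+2 k.+1 (D F))).
  apply: (@rmorph_model_eq _ _ _ M k.+1 _ (map_poly D \o (S \o d))
     (S \o (d \o (s k.+2 k.+1 \o D)))) F => /=.
  - by move=> a; rewrite mdp_c mS_c map_polyC /= !mD_c ms_c mdp_c mS_c.
  - move=> n n0; rewrite mdp_p // (rmorphD S) (rmorphM S) (rmorphXn S) (rmorphM S).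
    rewrite mS_p // !mS_c mS_y // -polyCM -polyC_exp -polyCM.
    rewrite (rmorphD (map_poly D)) (rmorphB (map_poly D)) (rmorphM (map_poly D)) /=.
    rewrite !map_polyC map_polyXn /= mD_p // !mD_c.
    rewrite (rmorphM D) (rmorphXn D) (rmorphM D) !mD_c mD_y //.
    rewrite (rmorphD (s _ _)) (rmorphM (s _ _)) (rmorphXn (s _ _)) ms_p // ms_c ms_yr //.
    rewrite (rmorphD d) (rmorphM d) (rmorphXn d) mdp_c mdp_p // mdp_y; last lia.
    rewrite !(rmorphD S) !(rmorphM S) !(rmorphXn S) (rmorphM S) !mS_c mS_p //.
    by rewrite !mS_y // !polyCD !polyCM !polyC_exp !polyCM; ring.
  - move=> j jk; rewrite mD_y //; have [->|jk1] := eqVneq j k.+1.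
      by rewrite ms_yl // !mdp_y // !mS_last map_polyX.
    rewrite ms_y_id //; try lia; rewrite !mdp_y //; last lia.
    by rewrite mS_y ?map_polyC /= ?mD_y ?mS_y //; lia.
have eT : ('X - v%:P) * S (d (T k.+1 (D F)))
    = (c k.+2 (q - 1) * v * d F)%:P + ('X - (c k.+2 q * v)%:P) * map_poly D (S (d F)).
  have phiM G G' : S (d (G * G')) = S (d G) * S (d G') by rewrite !rmorphM.
  have phiB G G' : S (d (G - G')) = S (d G) - S (d G') by rewrite !rmorphB.
  have phiD G G' : S (d (G + G')) = S (d G) + S (d G') by rewrite !rmorphD.
  have phic b : S (d (c k.+2 b)) = (c k.+2 b)%:P by rewrite mdp_c mS_c.
  have phiX : S (d (y k.+2 k.+2)) = 'X by rewrite mdp_y // mS_last.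
  have phiv : S (d (y k.+2 k.+1)) = v%:P by rewrite mdp_y ?mS_y //; lia.
  have := congr1 (fun G => S (d G)) (mT_mulE (D F) k1).
  rewrite /= !(phiM, phiB, phiD, phic) phiX phiv -eDS mS_d_D => e.
  by rewrite mulrC e !polyCM; ring.
rewrite !mC_E // 2!(rmorphM D) mD_c Da; congr (_ * _).
rewrite rmorph_pairing (eq_pairing DJ) -(eq_pairing NK) !pairing_seq_mul_shift.
by rewrite eT pairingD pairing_shift_C add0r.
Qed.

End CommutatorRelations.

(** * The operators z_i and their commutation with d_+ *)

Section ZOperators.
Variables (K : fieldType) (q t : K) (M : model q t).
Hypothesis charK : forall n, n.+1%:R != 0 :> K.
Hypothesis q0 : q != 0.
Local Notation V := (mV M).
Local Notation c := (mc M).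
Local Notation y := (my M).
Local Notation D := (@mD _ _ _ M _).
Local Notation d := (@mdp _ _ _ M _).
Local Notation dm := (@mdm _ _ _ M _).
Local Notation T := (@mT _ _ _ M _).
Local Notation Tinv := (@mTinv _ _ _ M _).
Local Notation C := (@mC _ _ _ M _).

Definition mTs k (r : seq nat) (F : V k) : V k := foldr (fun i G => T i G) F r.

Definition mTinvs k (r : seq nat) (F : V k) : V k := foldl (fun G i => Tinv i G) F r.

Definition mdplus k (F : V k) : V k.+1 := mTs (iota 1 k) (D F).

Definition mz1 k (F : V k.+1) : V k.+1 :=
  c k.+1 (q ^+ k / (q^-1 - 1)) * C (mTinvs (iota 1 k) F).

Fixpoint mz k (i : nat) (F : V k.+1) : V k.+1 :=
  match i with
  | 0 | 1 => mz1 F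
  | (i'.+1 as i1).+1 => c k.+1 q^-1 * T i1 (mz i1 (T i1 F))
  end.

Lemma mTinvsK k r : all (fun i => 0 < i < k)%N r -> cancel (@mTinvs k r) (@mTs k r).
Proof.
elim: r => // i r IHr /andP[ik rk] F.
by rewrite -[RHS](mTinvK q0 ik) -[mTinv i F in RHS](IHr rk).
Qed.

Lemma mTsK k r : all (fun i => 0 < i < k)%N r -> cancel (@mTs k r) (@mTinvs k r).
Proof.
elim: r => // i r IHr /andP[ik rk] F.
by rewrite -[RHS](IHr rk) -[mTs r F in RHS](mTK q0 ik).
Qed.

Lemma all_iota k m n : (0 < m)%N -> (m + n <= k)%N ->
  all (fun i => 0 < i < k)%N (iota m n).
Proof. by move=> m0 mnk; apply/allP => i; rewrite mem_iota; lia. Qed.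

Lemma mTs_scale k r a (F : V k) : all (fun i => 0 < i < k)%N r ->
  mTs r (c k a * F) = c k a * mTs r F.
Proof.
elim: r => //= i r IHr /andP[ik rk]; rewrite IHr //.
by rewrite mTMl // ms_c.
Qed.

Lemma mTs_S k m (F : V k) : mTs (iota 1 m.+1) F = mTs (iota 1 m) (T m.+1 F).
Proof. by rewrite -[m.+1 in LHS]addn1 iotaD /mTs foldr_cat /= add1n. Qed.

Lemma mTs_intertwine k l a b n (f : V k -> V l) (F : V k) :
  (forall i G, (a <= i < a + n)%N -> f (T i G) = T (i + b)%N (f G)) ->
  f (mTs (iota a n) F) = mTs (iota (a + b)%N n) (f F).
Proof.
elim: n a => //= n IHn a fT; rewrite fT; last lia.
by rewrite IHn // => i G ia; apply: fT; lia.
Qed.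

Lemma mTs_far k m j (F : V k) : (m.+1 < j < k)%N ->
  mTs (iota 1 m) (T j F) = T j (mTs (iota 1 m) F).
Proof.
move=> jk; rewrite -[in RHS](addn0 1%N); apply/esym.
apply: (@mTs_intertwine k k 1 0 m (@mT _ _ _ M k j)) => i G im.
by rewrite addn0 mT_comm //; lia.
Qed.

(** The braid identity T_1 ... T_m T_i = T_{i+1} T_1 ... T_m. *)
Lemma mTs_T k m i (F : V k) : (0 < i < m)%N -> (m < k)%N ->
  mTs (iota 1 m) (T i F) = T i.+1 (mTs (iota 1 m) F).
Proof.
elim: m i F => [|m IHm] i F im mk; first lia.
rewrite !mTs_S; have [i_lt_m|le_mi] := ltnP i m.
  by rewrite mT_comm ?(IHm i) //; lia.
case: m IHm im mk le_mi => [|m] IHm im mk le_mi; first lia.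
have -> : i = m.+1 by lia.
by rewrite !mTs_S mT_braid // mTs_far //; lia.
Qed.

Lemma mdplus_T k i (F : V k) : (0 < i < k)%N -> mdplus (T i F) = T i.+1 (mdplus F).
Proof. by move=> ik; rewrite /mdplus mD_T // mTs_T. Qed.

Lemma mC_T k i (F : V k.+1) : (0 < i < k)%N -> C (T i F) = T i.+1 (C F).
Proof.
move=> ik; have TB G G' : T i.+1 (G - G') = T i.+1 G - T i.+1 G' :> V k.+1.
  have := mT_linear (-1) G' G (_ : (0 < i.+1 < k.+1)%N).
  by rewrite rmorphN1 !mulN1r ![- _ + _]addrC; apply; lia.
by rewrite /mC TB mdm_T // mdp_T // mdp_T ?mdm_T //; lia.
Qed.

Lemma mz1_dplus k (F : V k) : q != 1 ->
  mz1 (mdplus F) = - c k.+1 (t * q ^+ k.+1) * y k.+1 1 * d F.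
Proof.
move=> q1; rewrite /mz1 /mdplus mTsK ?all_iota // mC_D // /ty1 !mulrA -!rmorphM -rmorphN.
have q1' : q^-1 - 1 != 0 by rewrite subr_eq0 invr_eq1.
congr (c k.+1 _ * _ * _); rewrite exprS.
(* The denominator in the normalization of z_1 cancels the factor q - 1 of the commutator, leaving
   the sign and one more power of q. *)
have -> : q - 1 = - (q * (q^-1 - 1)) by rewrite mulrBr mulfV //; ring.
have bK := mulVf q1'; set b := q^-1 - 1 in bK *.
transitivity (- (t * (q * q ^+ k)) * (b^-1 * b)); first by ring.
by rewrite bK mulr1.
Qed.

(** With F = T_1 ... T_k G, T_1 d_+ F is (T_1 ... T_{k+1})^2 applied to D G. The inverses in z_1
    remove one factor, and the commutator passes the other. *)
Lemma mz2_dplus k (F : V k.+1) : mz 2 (mdplus F) = mdplus (mz1 F).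
Proof.
have r1 : all (fun i => 0 < i < k.+1)%N (iota 1 k) by exact: all_iota.
have r2 : all (fun i => 0 < i < k.+2)%N (iota 1 k.+1) by exact: all_iota.
rewrite /= -[in LHS](mTinvsK r1 F) {2}/mz1.
move: (mTinvs _ F) => G.
have -> : T 1 (mdplus (mTs (iota 1 k) G))
    = mTs (iota 1 k.+1) (mTs (iota 1 k.+1) (D G)).
  rewrite /mdplus [in RHS]/= -/(mTs _ _); congr (T 1 _).
  rewrite (@mTs_intertwine _ _ 1 0 k (@mD _ _ _ M k.+1)); last first.
    by move=> i G' ik; rewrite addn0 mD_T //; lia.
  rewrite (@mTs_intertwine _ _ (1 + 0) 1 k (@mTs k.+2 (iota 1 k.+1))) //.
  by move=> i G' ik; rewrite addn1 mTs_T //; lia.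
rewrite /mz1 mTsK // mTs_S.
have -> : C (mTs (iota 1 k) (T k.+1 (D G))) = mTs (iota 2 k) (D (C G)).
  rewrite (@mTs_intertwine _ _ 1 1 k (@mC _ _ _ M k.+1)) ?mC_T_D //.
  by move=> i G' ik; rewrite addn1 mC_T //; lia.
rewrite mTMl ?ms_c // mulrA -rmorphM /mdplus (rmorphM D) mD_c mTs_scale //.
congr (c k.+2 _ * _); rewrite exprS !mulrA mulVf //; ring.
Qed.

Lemma mz_SS k i (F : V k.+1) :
  mz i.+2 F = c k.+1 q^-1 * T i.+1 (mz i.+1 (T i.+1 F)).
Proof. by []. Qed.

Lemma mz_dplus k i (F : V k.+1) : (1 <= i <= k.+1)%N ->
  mz i.+1 (mdplus F) = mdplus (mz i F).
Proof.
case: i => // i; elim: i F => [|i IHi] F ik; first exact: mz2_dplus.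
rewrite mz_SS -mdplus_T; last lia.
rewrite IHi; last lia.
rewrite -mdplus_T; last lia.
by rewrite mz_SS /mdplus (rmorphM D) mD_c mTs_scale // all_iota.
Qed.

Lemma mdplus1 k : mdplus (1 : V k) = 1.
Proof.
rewrite /mdplus rmorph1; have := @all_iota k.+1 1 k erefl (leqnn _).
elim: (iota 1 k) => //= i r IHr /andP[ik rk]; rewrite -/(mTs r 1) IHr // mT_id //.
exact: rmorph1.
Qed.

End ZOperators.

(** * The action on syntactic paths *)

Section Action.
Variables (K : fieldType) (q t : K) (M : model q t).
Hypothesis charK : forall n, n.+1%:R != 0 :> K.
Hypothesis q0 : q != 0.
Local Notation V := (mV M).
Local Notation c := (mc M).
Local Notation d := (@mdp _ _ _ M _).
Local Notation dm := (@mdm _ _ _ M _).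
Local Notation T := (@mT _ _ _ M _).
Local Notation Tinv := (@mTinv _ _ _ M _).
Local Notation C := (@mC _ _ _ M _).

Fixpoint mact i j (e : expr K i j) : V i -> V j :=
  match e in expr _ i j return V i -> V j with
  | Ge k => fun F => F
  | Gdp k => fun F => d F
  | Gdm k => fun F => dm F
  | @GT _ k i h => fun F => Tinv i F
  | Eadd _ _ a b => fun F => mact a F + mact b F
  | Escale _ j x a => fun F => c j x * mact a F
  | Emul _ _ _ a b => fun F => mact a (mact b F)
  end.

Lemma mact_linear i j (e : expr K i j) x (F G : V i) :
  mact e (c i x * F + G) = c j x * mact e F + mact e G.
Proof.
elim: e x F G => {i j} [k|k|k|k i h|i j a IHa b IHb|i j y a IHa|i j l a IHa b IHb] x F G //=.
- exact: mdp_linear.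
- exact: mdm_linear.
- rewrite !mTinvE // mT_linear //; ring.
- by rewrite IHa IHb; ring.
- by rewrite IHa; ring.
- by rewrite IHb IHa.
Qed.

Lemma mact_comm k (F : V k.+1) : mact (Ecomm K k) F = C F.
Proof. by rewrite /= rmorphN1 mulN1r. Qed.

Lemma mact_defrel i j (a b : expr K i j) : defrel q^-1 a b -> mact a =1 mact b.
Proof.
case=> {i j a b} [k i h|k i h h'|k i j h h' ij|k i h h'|k i h h'|k h|k h|k h|k h] F.
- rewrite /= rmorph0 mul0r rmorphN1 mulN1r.
  (* Substituting F = T G and applying the injective T removes all inverses; what remains is the
     quadratic relation of T. *)
  rewrite -[F](mTinvK q0 h); move: (Tinv i F) => G; rewrite mTK //.
  apply: (mT_inj q0 h); rewrite mTD // mTinvK //.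
  set X := G + _; have -> : T i (- X) = - T i X.
    by rewrite -mulN1r -(rmorphN1 (c k)) mTMl ?ms_c // rmorphN1 mulN1r.
  rewrite /X mTD // mTMl ?ms_c // mT_quad //.
  rewrite (@mT_id _ _ _ _ _ _ 0) ?rmorph0 //.
  have qV : c k q^-1 * c k q = 1 by rewrite -rmorphM mulVf // rmorph1.
  rewrite rmorphB rmorph1.
  transitivity ((1 - c k q^-1 * c k q) * (G - T i G)); first by ring.
  by rewrite qV subrr mul0r.
- rewrite /=; have hi : (0 < i)%N by lia.
  set A := LHS; have -> : F = T i.+1 (T i (T i.+1 A)).
    by rewrite -mT_braid // /A !mTinvK.
  by rewrite !mTK.
- rewrite /=; set A := LHS.
  have -> : F = T i (T j A) by rewrite mT_comm // /A !mTinvK.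
  by rewrite !mTK.
- by rewrite /= -[F in LHS](mTinvK q0 h') mdm_T // mTK.
- by rewrite /= -[F in RHS](mTinvK q0 h) mdp_T // mTK.
- by rewrite /= -[in LHS](mT1_d2 F) mTK.
- by rewrite /= -[F in RHS](mTinvK q0 h) mdm2_T.
(* The syntactic commutator is kept folded so that it can be replaced by [C]. *)
- change (dm (mact (Ecomm K k.+1) (Tinv k.+1 F))
    = c k.+1 q^-1 * mact (Ecomm K k) (dm F)); rewrite !mact_comm.
  rewrite -[F in RHS](mTinvK q0 h) -mdm_C_T // mulrA -rmorphM mulVf //.
  by rewrite rmorph1 mul1r.
- change (Tinv 1 (mact (Ecomm K k.+1) (d F))
    = c k.+2 q^-1 * d (mact (Ecomm K k) F)); rewrite !mact_comm.
  apply: (mT_inj q0 h); rewrite mTinvK // mTMl ?ms_c // mT1_d_C //.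
  by rewrite mulrA -rmorphM mulVf // rmorph1 mul1r.
Qed.

Lemma mact_aeq i j (a b : expr K i j) : aeq q^-1 a b -> mact a =1 mact b.
Proof.
elim=> {i j a b} /=.
- by move=> i j a b; exact: mact_defrel.
- by [].
- by move=> i j a b _ IH F; rewrite IH.
- by move=> i j a b e _ IH1 _ IH2 F; rewrite IH1.
- by move=> i j a a' b b' _ IHa _ IHb F; rewrite IHa IHb.
- by move=> i j x a a' _ IHa F; rewrite IHa.
- by move=> i j l a a' b b' _ IHa _ IHb F; rewrite IHb IHa.
- by move=> i j a b e F; rewrite addrA.
- by move=> i j a b F; rewrite addrC.
- by move=> i j a b F; rewrite rmorph0 mul0r addr0.
- by move=> i j a F; rewrite rmorph1 mul1r.
- by move=> i j x x' a F; rewrite rmorphM mulrA.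
- by move=> i j x a b F; rewrite mulrDr.
- by move=> i j x x' a F; rewrite rmorphD mulrDl.
- by [].
- by [].
- by [].
- by [].
- move=> i j l a b e F; have := mact_linear a 1 (mact b F) (mact e F).
  by rewrite !rmorph1 !mul1r.
- by [].
- move=> i j l x a b F; have := mact_linear a x (mact b F) 0.
  have -> : mact a 0 = 0.
    by have := mact_linear a (-1) 0 0; rewrite !rmorphN1 mulr0 addr0 mulN1r addNr.
  by rewrite !addr0.
Qed.

End Action.

Lemma rmorph_sum_mulN (A R : comNzRingType) (g : {rmorphism A -> R}) n a b
    (x y : 'I_n -> A) a' x' :
  a * b = \sum_(i < n) x i * y i -> g a = a' -> (forall i, g (x i) = - x' i) ->
  a' * g b = - \sum_(i < n) x' i * g (y i).
Proof.
move=> e <- ex; rewrite -rmorphM e rmorph_sum -sumrN.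
by apply: eq_bigr => i _; rewrite rmorphM ex mulNr.
Qed.

(** * Newton's identity for h_n[-X] *)

Section CompleteHomogeneous.
Variable K : fieldType.
Hypothesis charK : forall n, n.+1%:R != 0 :> K.

Lemma size_hseq n : size (hseq K n) = n.+1.
Proof. by elim: n => //= n IHn; rewrite size_rcons IHn. Qed.

Lemma nth_hseq n i : (i <= n)%N -> (hseq K n)`_i = hsym K i.
Proof.
elim: n => [|n IHn]; first by rewrite leqn0 => /eqP ->.
rewrite leq_eqVlt => /predU1P[->//|]; rewrite ltnS => le_in.
by rewrite /= nth_rcons size_hseq ltnS le_in IHn.
Qed.

Lemma rmorph_mulVK (R : comNzRingType) (f : {rmorphism K -> R}) a x :
  a != 0 -> f a * (f a^-1 * x) = x.
Proof. by move=> a0; rewrite mulrA -rmorphM mulfV // rmorph1 mul1r. Qed.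

Lemma hsymS n : symC n.+1%:R * hsym K n.+1
  = \sum_(i < n.+1) psum K i.+1 * hsym K (n - i).
Proof.
have -> : hsym K n.+1 = symC (n.+1%:R)^-1
    * \sum_(i < n.+1) psum K i.+1 * (hseq K n)`_(n - i).
  rewrite /hsym -[hseq K n.+1]/(rcons (hseq K n) _).
  by rewrite nth_rcons size_hseq ltnn eqxx.
apply: etrans (rmorph_mulVK (@symC K) _ (charK n)) _; apply: eq_bigr => i _.
by rewrite nth_hseq // leq_subr.
Qed.

Lemma symV_hneg0 k : symV k (hneg K 0) = 1.
Proof.
exact: (rmorph1 (symV k \o pleth (@symC K) (fun m => - psum K m))).
Qed.

Lemma symV_hnegS k n : scalV k n.+1%:R * symV k (hneg K n.+1)
  = - \sum_(i < n.+1) psumV K k i.+1 * symV k (hneg K (n - i)).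
Proof.
apply: (@rmorph_sum_mulN _ _ (symV k \o pleth (@symC K) (fun m => - psum K m))
  _ _ _ _ _ _ (fun i => psumV K k i.+1) (hsymS n)) => [|i].
  exact: (congr1 (symV k) (pleth_symC (@symC K) _ _)).
apply: etrans (congr1 (symV k) (pleth_psum (@symC K) _ (ltn0Sn i))) _.
exact: (rmorphN (symV k)).
Qed.
End CompleteHomogeneous.

Lemma rmorphDMX (A R : comNzRingType) (g : {rmorphism A -> R}) n a b z a' b' z' :
  g a = a' -> g b = b' -> g z = z' -> g (a + b * z ^+ n) = a' + b' * z' ^+ n.
Proof. by rewrite rmorphD rmorphM rmorphXn => -> -> ->. Qed.

(** * The concrete V_k as a model *)

Section Model.
Opaque scalV psumV yv symV.
Variables (K : fieldType) (q t : K).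
Hypothesis charK : forall n, n.+1%:R != 0 :> K.

Lemma sop_c k i a : sop i (scalV k a) = scalV k a :> V K k.
Proof. exact: (substV_scal (@scalV K k)). Qed.

Lemma sop_p k i n : (0 < n)%N -> sop i (psumV K k n) = psumV K k n.
Proof. exact: (substV_psum (@scalV K k)). Qed.

Lemma sop_y k i j : (0 < j <= k)%N -> sop i (yv K k j) = yv K k (swap_index i j).
Proof. exact: (substV_y (@scalV K k)). Qed.

Lemma shiftX_c k a : shiftX q (scalV k a) = scalV k.+1 a :> V K k.+1.
Proof. exact: (substV_scal (@scalV K k.+1)). Qed.

Lemma shiftX_p k n : (0 < n)%N -> shiftX q (psumV K k n)
  = psumV K k.+1 n + scalV k.+1 (q ^+ n - 1) * yv K k.+1 k.+1 ^+ n.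
Proof. exact: (substV_psum (@scalV K k.+1)). Qed.

Lemma shiftX_y k i : (0 < i <= k)%N -> shiftX q (yv K k i) = yv K k.+1 i.
Proof. exact: (substV_y (@scalV K k.+1)). Qed.

Lemma gamma_c k a : gamma t (scalV k.+1 a) = scalV k.+1 a :> V K k.+1.
Proof. exact: (substV_scal (@scalV K k.+1)). Qed.

Lemma gamma_p k n : (0 < n)%N -> gamma t (psumV K k.+1 n) = psumV K k.+1 n.
Proof. exact: (substV_psum (@scalV K k.+1)). Qed.

Lemma gamma_y k i : (0 < i <= k.+1)%N -> gamma t (yv K k.+1 i)
  = if (i <= k)%N then yv K k.+1 i.+1 else scalV k.+1 t * yv K k.+1 1.
Proof. exact: (substV_y (@scalV K k.+1)). Qed.

Lemma dplus_star_c k a : dplus_star q t (scalV k a) = scalV k.+1 a :> V K k.+1.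
Proof. by rewrite /dplus_star shiftX_c gamma_c. Qed.

Lemma dplus_star_p k n : (0 < n)%N -> dplus_star q t (psumV K k n)
  = psumV K k.+1 n + scalV k.+1 (q ^+ n - 1) * (scalV k.+1 t * yv K k.+1 1) ^+ n.
Proof.
move=> n0; apply: etrans (congr1 (@gamma K t k) (shiftX_p _ n0)) _.
have e : gamma t (yv K k.+1 k.+1) = scalV k.+1 t * yv K k.+1 1.
  by apply: etrans (gamma_y _) _; [exact: leqnn | rewrite ltnn].
exact: (rmorphDMX (g := @gamma K t k) n (gamma_p k n0) (gamma_c k _) e).
Qed.

Lemma dplus_star_y k i : (0 < i <= k)%N ->
  dplus_star q t (yv K k i) = yv K k.+1 i.+1.
Proof.
move=> ik; rewrite /dplus_star (shiftX_y ik).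
by apply: etrans (gamma_y _) _; [lia | case/andP: ik => _ ->].
Qed.

Lemma shiftZ_c k a : shiftZ q (scalV k a) = (scalV k a)%:P :> {poly V K k}.
Proof. exact: (substV_scal (polyC \o @scalV K k)). Qed.

Lemma shiftZ_p k n : (0 < n)%N -> shiftZ q (psumV K k n)
  = (psumV K k n)%:P - (scalV k (q ^+ n - 1))%:P * 'X^n.
Proof. exact: (substV_psum (polyC \o @scalV K k)). Qed.

Lemma shiftZ_y k i : (0 < i <= k)%N -> shiftZ q (yv K k i) = (yv K k i)%:P.
Proof. exact: (substV_y (polyC \o @scalV K k)). Qed.

Lemma shiftY_polyC k (F : V K k.+1) G : muni F = G%:P -> shiftY q F = shiftZ q G.
Proof. by move=> eF; rewrite /shiftY eF map_polyC hornerC. Qed.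

Lemma shiftY_c k a : shiftY q (scalV k.+1 a) = (scalV k a)%:P :> {poly V K k}.
Proof. by rewrite -shiftZ_c; apply: shiftY_polyC; exact: muniC. Qed.

Lemma shiftY_p k n : (0 < n)%N -> shiftY q (psumV K k.+1 n)
  = (psumV K k n)%:P - (scalV k (q ^+ n - 1))%:P * 'X^n.
Proof. by move=> n0; rewrite -(shiftZ_p _ n0); apply: shiftY_polyC; exact: muniC. Qed.

Lemma muni_X (R : comNzRingType) k (i : 'I_k.+1) : muni ('X_i : mpoly.mpoly k.+1 R)
  = match split (cast_ord (esym (addn1 k)) i) with
    | inl j => ('X_j)%:P | inr _ => 'X end.
Proof. by rewrite /muni mpoly.mmapX mpoly.mmap1U. Qed.

Lemma shiftY_y k i : (0 < i <= k)%N -> shiftY q (yv K k.+1 i) = (yv K k i)%:P.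
Proof.
move=> ik; rewrite -(shiftZ_y ik); apply: shiftY_polyC.
case: i ik => [|i ik]; first by case/andP.
have ik1 : (i < k.+1)%N by lia.
rewrite (yvE K (Ordinal ik1)) (yvE K (Ordinal ik)) muni_X.
case: splitP => [j /= ej|j /=]; last by lia.
by congr (_ %:P); congr ('X_ _); apply: val_inj.
Qed.

Lemma shiftY_last k : shiftY q (yv K k.+1 k.+1) = 'X.
Proof.
have e : muni (yv K k.+1 k.+1) = 'X.
  rewrite (yvE K (@ord_max k)) muni_X; case: splitP => [j /= ej|//].
  by have := ltn_ord j; lia.
by rewrite /shiftY e map_polyX hornerX.
Qed.

(** B_{i+1} extracts z^{i+1}. With u = 1/z this is the residue with y_{k+1}^i replaced by u^i and
    one more factor u. *)
Lemma dminusE k (F : V K k.+1) :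
  dminus q F = - pairing (fun n => symV k (hneg K n)) ('X * shiftY q F).
Proof.
rewrite /dminus; congr (- _); rewrite pairing_XM /shiftY.
rewrite (horner_coef_wide _ (size_poly _ _)) pairing_sum.
apply: eq_bigr => i _; rewrite coef_map pairing_MXn /Bop /pairing.
by apply: eq_bigr => j _; rewrite addSn.
Qed.

Definition sym_model : model q t :=
  @Model K q t (V K) (@scalV K) (@psumV K) (@yv K) (@sop K) (@shiftX K q)
    (@dplus_star K q t) (@shiftY K q) (fun k n => symV k (hneg K n)) (@dminus K q)
    (@V_ind K) (@yv_sub_rreg K) sop_c sop_p sop_y shiftX_c shiftX_p shiftX_y
    dplus_star_c dplus_star_p dplus_star_y shiftY_c shiftY_p shiftY_y shiftY_last
    (@symV_hneg0 K) (symV_hnegS charK) dminusE.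

Opaque V dplus_star dminus shiftX sop.

Lemma z1_model k (F : V K k.+1) : z1 q t F = mz1 (M := sym_model) F.
Proof. by rewrite /mz1 /mC /mTinvs. Qed.

Lemma zop_model k i (F : V K k.+1) : zop q t i F = mz (M := sym_model) i F.
Proof.
elim: i F => [|[|i] IHi] F; [exact: z1_model | exact: z1_model |].
exact: (congr1 (fun G => scalV k.+1 q^-1 * Top q i.+1 G) (IHi (Top q i.+1 F))).
Qed.

Hypotheses (q0 : q != 0) (q1 : q != 1).

Lemma zop_dplus k i (F : V K k.+1) : (1 <= i <= k.+1)%N ->
  zop q t i.+1 (dplus q F) = dplus q (zop q t i F).
Proof.
move=> ik; apply: etrans (zop_model _ _) _.
apply: etrans (_ : mz (M := sym_model) i.+1 (mdplus (M := sym_model) F) = _) _.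
  exact: mz_dplus.
exact: (congr1 (@dplus K q k.+1) (esym (zop_model i F))).
Qed.

Lemma zop1_dplus k (F : V K k) : zop q t 1 (dplus q F)
  = - scalV k.+1 (t * q ^+ k.+1) * yv K k.+1 1 * dplus_star q t F.
Proof.
apply: etrans (zop_model _ _) _.
exact: (mz1_dplus (M := sym_model) charK q0 F q1).
Qed.

Lemma yv_dplus_star k i (F : V K k) : (1 <= i <= k)%N ->
  yv K k.+1 i.+1 * dplus_star q t F = dplus_star q t (yv K k i * F).
Proof.
move=> ik; apply/esym; apply: etrans (rmorphM (@dplus_star K q t k) _ _) _.
exact: (congr1 (fun G => G * dplus_star q t F) (dplus_star_y ik)).
Qed.

Lemma iter1_dplus m :
  iter1 (fun k => @dplus_star K q t k) m = iter1 (fun k => @dplus K q k) m.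
Proof.
have e1 : iter1 (fun k => @dplus_star K q t k) m = 1.
  elim: m => [//|m IHm]; apply: etrans (congr1 (@dplus_star K q t m) IHm) _.
  exact: (rmorph1 (@dplus_star K q t m)).
apply: etrans e1 (esym _); elim: m => [//|m IHm].
apply: etrans (congr1 (@dplus K q m) IHm) _.
exact: (mdplus1 sym_model q0 m).
Qed.

End Model.

(** * Specialization to Q(q,t) *)

Lemma Qqt_natr_neq0 n : n.+1%:R != 0 :> Qqt.
Proof.
have -> : n.+1%:R = FracField.tofrac (mpolyC 2 (n.+1%:R : rat)) :> Qqt.
  by rewrite mpolyC_nat; exact: (esym (rmorph_nat (@FracField.tofrac _) _)).
by rewrite tofrac_eq0 mpolyC_eq0 Num.Theory.pnatr_eq0.
Qed.

Lemma q_neq0 : q_ != 0.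
Proof.
rewrite tofrac_eq0; apply/eqP => /(congr1 (mcoeff U_(0%R : 'I_2)%MM)).
by rewrite mcoeffX eqxx mcoeff0 => /eqP; rewrite oner_eq0.
Qed.

Lemma q_neq1 : q_ != 1.
Proof.
rewrite -tofrac1 tofrac_eq; apply/eqP => /(congr1 (mcoeff U_(0%R : 'I_2)%MM)).
by rewrite mcoeffX eqxx mcoeff1 mnm1_eq0 => /eqP; rewrite oner_eq0.
Qed.

Theorem theorem6p1 :
  (exists act : forall i j : nat, expr Qqt i j -> V Qqt i -> V Qqt j,
     is_action q_^-1 act /\
     (forall (k i : nat) (h : (0 < i < k)%N) (F : V Qqt k),
        act k k (GT Qqt h) F = Tinv q_ i F) /\
     (forall (k : nat) (F : V Qqt k.+1), act k.+1 k (Gdm Qqt k) F = dminus q_ F) /\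
     (forall (k : nat) (F : V Qqt k), act k k (Ge Qqt k) F = F) /\
     (forall (k : nat) (F : V Qqt k),
        act k k.+1 (Gdp Qqt k) F = dplus_star q_ t_ F)) /\
  (forall (k i : nat) (F : V Qqt k.+1), (1 <= i <= k.+1)%N ->
     zop q_ t_ i.+1 (dplus q_ F) = dplus q_ (zop q_ t_ i F)) /\
  (forall (k i : nat) (F : V Qqt k), (1 <= i <= k)%N ->
     yv Qqt k.+1 i.+1 * dplus_star q_ t_ F = dplus_star q_ t_ (yv Qqt k i * F)) /\
  (forall (k : nat) (F : V Qqt k),
     zop q_ t_ 1 (dplus q_ F)
     = - scalV k.+1 (t_ * q_ ^+ k.+1) * yv Qqt k.+1 1 * dplus_star q_ t_ F) /\
  (forall m : nat, (1 <= m)%N ->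
     iter1 (fun k => @dplus_star Qqt q_ t_ k) m = iter1 (fun k => @dplus Qqt q_ k) m).
Proof.
have charQ := Qqt_natr_neq0; have q0 := q_neq0; have q1 := q_neq1.
pose M := sym_model q_ t_ charQ.
split.
  exists (@mact _ _ _ M); split; [split | repeat split].
  - exact: (@mact_aeq _ _ _ M charQ q0).
  - exact: (@mact_linear _ _ _ M q0).
  - by [].
  - by [].
  - by [].
  - by [].
split; first by move=> k i F; exact: zop_dplus.
split; first by move=> k i F; exact: yv_dplus_star.
split; first by move=> k F; exact: zop1_dplus.
by move=> m _; exact: iter1_dplus.
Qed.
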